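(* Let $\mathcal H$ be a Heyting category, $A$ an order partial applicative structure in $\mathcal H$ and $\phi$ a combinatory complete external filter of $A$. For each family of downsets $Y\subseteq A\times X$ let $\Sigma Y=\{x\in X\mid\exists a\in A.\,(a,x)\in Y\}$. The map $\Sigma$ defines a subfunctor of $\mathsf DA/\phi:\mathcal DA/\phi\to\mathcal H$ if and only if all $U\in\phi$ are inhabited. This subfunctor is regular and factors uniquely (up to isomorphism) through $\mathrm{Asm}(\mathsf DA/\phi)$.
   Context: All categories are small. A Heyting category is a regular category in which every $\mathrm{Sub}(X)$ has finite joins and every $f^{-1}$ between subobject posets has a right adjoint. Set-builder notation refers to its internal language. A subobject $U$ of $A$ is inhabited if $U\to1$ is a regular epimorphism. Order partial applicative structure: an object $A$ with a preorder $\le$ and a partial binary operator $(x,y)\mapsto xy$ with domain $D\subseteq A^2$ ($xy\downarrow$ means $(x,y)\in D$) such that $x\le x'$, $y\le y'$, $x'y'\downarrow$ imply $xy\downarrow$, $xy\le x'y'$. Partial combinatory functions are the least class of partial functions $A^n\rightharpoonup A$ (all arities) containing projections and closed under pointwise application. For $f:A^{n+1}\rightharpoonup A$, $[\![f]\!]=\{r\in A\mid\forall\vec x\in A^n.\,r\vec x\downarrow,\ \forall\vec y\in\mathrm{dom}f.\ r\vec y\downarrow\wedge r\vec y\le f(\vec y)\}$ (application associates to the left). $\mathbf DA$ is the set of downward closed subobjects of $A$; for $U,V\in\mathbf DA$, $UV\downarrow$ iff $U\times V\subseteq D$, and then $UV=\{z\mid\exists x\in U,y\in V.\,z\le xy\}$.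 An external filter is $\phi\subseteq\mathbf DA$ upward closed under $\subseteq$ and closed under defined application; it is combinatory complete if $[\![f]\!]\in\phi$ for all partial combinatory $f$. Realizability fibration $\mathsf DA/\phi:\mathcal DA/\phi\to\mathcal H$: objects of $\mathcal DA/\phi$ are pairs $(X,Y)$, where $Y\subseteq A\times X$ is downward closed in the $A$-coordinate (family of downsets); a morphism $(X,Y)\to(X',Y')$ is an $f:X\to X'$ such that for some $U\in\phi$, for all $u\in U$, $(a,x)\in Y$, $ua\downarrow$ and $(ua,f(x))\in Y'$. The functor sends $(X,Y)$ to $X$. Supine means coCartesian. $\mathrm{Asm}(F)$, for a fibred locale $F:\mathcal F\to\mathcal B$, is the localization of $\mathcal F$ obtained by formally inverting the supine monomorphisms (category of fractions $Q:\mathcal F\to\mathrm{Asm}(F)$); factoring through $\mathrm{Asm}(F)$ means factoring through $Q$, up to natural isomorphism.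
   Formalization: The formal theorem additionally assumes that A is inhabited (A→1 is a regular epimorphism); otherwise the claim fails, e.g. in Set with A empty and φ={∅}, where Σ is a subfunctor but ∅∈φ is not inhabited. *)

(* Defs.v *)
From Stdlib Require Import ssreflect.
From Stdlib Require Import ClassicalEpsilon FunctionalExtensionality.
From Stdlib Require Import PropExtensionality ProofIrrelevance.

Set Implicit Arguments.
Unset Strict Implicit.
Unset Printing Implicit Defensive.

Definition some {T : Type} (h : inhabited T) : T := epsilon h (fun _ => True).

(** * Categories *)

Record Category := {
  Obj :> Type;
  Hom : Obj -> Obj -> Type;
  idm : forall X, Hom X X;
  comp : forall X Y Z, Hom Y Z -> Hom X Y -> Hom X Z;
  comp_id_l : forall X Y (f : Hom X Y), comp (idm Y) f = f;
  comp_id_r : forall X Y (f : Hom X Y), comp f (idm X) = f;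
  comp_assoc : forall X Y Z W (h : Hom Z W) (g : Hom Y Z) (f : Hom X Y),
    comp h (comp g f) = comp (comp h g) f
}.
Arguments Hom {c} X Y.
Arguments idm {c} X.
Arguments comp {c X Y Z} g f.
Notation "g ∘ f" := (comp g f) (at level 40, left associativity).

Record Functor (C D : Category) := {
  fobj :> C -> D;
  fmap : forall X Y, Hom X Y -> Hom (fobj X) (fobj Y);
  fmap_id : forall X, fmap (idm X) = idm (fobj X);
  fmap_comp : forall X Y Z (g : @Hom C Y Z) (f : Hom X Y),
    fmap (g ∘ f) = fmap g ∘ fmap f
}.
Arguments fmap {C D} _ {X Y} _.

Definition functor_comp (C D E : Category)
    (G : Functor D E) (F : Functor C D) : Functor C E.
Proof.
refine {| fobj X := G (F X); fmap X Y f := fmap G (fmap F f) |}.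
- by move=> X; rewrite !fmap_id.
- by move=> X Y Z g f; rewrite !fmap_comp.
Defined.

Definition is_iso (C : Category) (X Y : C) (f : Hom X Y) : Prop :=
  exists g : Hom Y X, g ∘ f = idm X /\ f ∘ g = idm Y.

Record NatIso (C D : Category) (F G : Functor C D) := {
  component :> forall X : C, Hom (F X) (G X);
  naturality : forall X Y (f : @Hom C X Y),
    component Y ∘ fmap F f = fmap G f ∘ component X;
  component_iso : forall X, is_iso (component X)
}.

(** * Regular and Heyting categories *)

Section Notions.
Context {C : Category}.

Definition mono (X Y : C) (f : Hom X Y) : Prop :=
  forall T (g h : Hom T X), f ∘ g = f ∘ h -> g = h.

Definition is_terminal (T : C) : Prop :=
  forall X : C, exists! f : Hom X T, True.

Definition is_pullback (P X Y Z : C) (f : Hom X Z) (g : Hom Y Z)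
    (p : Hom P X) (q : Hom P Y) : Prop :=
  f ∘ p = g ∘ q /\
  forall T (a : Hom T X) (b : Hom T Y), f ∘ a = g ∘ b ->
    exists! k : Hom T P, p ∘ k = a /\ q ∘ k = b.

Definition is_product (P X Y : C) (p : Hom P X) (q : Hom P Y) : Prop :=
  forall T (a : Hom T X) (b : Hom T Y),
    exists! k : Hom T P, p ∘ k = a /\ q ∘ k = b.

Definition is_coequalizer (X Y Q : C) (p q : Hom X Y) (e : Hom Y Q) : Prop :=
  e ∘ p = e ∘ q /\
  forall T (t : Hom Y T), t ∘ p = t ∘ q -> exists! k : Hom Q T, k ∘ e = t.

Definition regular_epi (X Y : C) (e : Hom X Y) : Prop :=
  exists Z (p q : Hom Z X), is_coequalizer p q e.

Record terminal_object := {
  term_obj : C;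
  term_prop : is_terminal term_obj
}.

Record pullback (X Y Z : C) (f : Hom X Z) (g : Hom Y Z) := {
  pb_obj : C;
  pb_fst : Hom pb_obj X;
  pb_snd : Hom pb_obj Y;
  pb_prop : is_pullback f g pb_fst pb_snd
}.

Record product (X Y : C) := {
  prod_obj : C;
  prod_fst : Hom prod_obj X;
  prod_snd : Hom prod_obj Y;
  prod_prop : is_product prod_fst prod_snd
}.

(** Subobjects are represented by monomorphisms; every notion below is
    invariant under isomorphism of subobjects. *)
Record Sub (X : C) := {
  sdom : C;
  sarr : Hom sdom X;
  smono : mono sarr
}.

(** Membership of generalized elements. *)
Definition mem (T X : C) (t : Hom T X) (S : Sub X) : Prop :=
  exists k : Hom T (sdom S), sarr S ∘ k = t.

Definition sub_le (X : C) (U V : Sub X) : Prop := mem (sarr U) V.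

Record image (X Y : C) (f : Hom X Y) := {
  im_sub : Sub Y;
  im_cover : Hom X (sdom im_sub);
  im_regular : regular_epi im_cover;
  im_eq : sarr im_sub ∘ im_cover = f
}.

(** Finite limits are given by a terminal object and pullbacks. *)
Record regular : Prop := {
  reg_terminal : inhabited terminal_object;
  reg_pullback : forall (X Y Z : C) (f : Hom X Z) (g : Hom Y Z),
    inhabited (pullback f g);
  reg_image : forall (X Y : C) (f : Hom X Y), inhabited (image f);
  reg_stable : forall (P X Y Z : C) (f : Hom X Z) (g : Hom Y Z)
      (p : Hom P X) (q : Hom P Y),
    is_pullback f g p q -> regular_epi f -> regular_epi q
}.

Lemma mono_comp (X Y Z : C) (g : Hom Y Z) (f : Hom X Y) :
  mono g -> mono f -> mono (g ∘ f).
Proof.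
move=> mg mf T a b; rewrite -!comp_assoc => e; exact: mf (mg _ _ _ e).
Qed.

Lemma mono_id (X : C) : mono (idm X).
Proof. by move=> T a b; rewrite !comp_id_l. Qed.

Lemma pullback_mono (P X Y Z : C) (f : Hom X Z) (g : Hom Y Z)
    (p : Hom P X) (q : Hom P Y) : is_pullback f g p q -> mono g -> mono p.
Proof.
move=> [e u] mg T a b eab.
have eq_ab : q ∘ a = q ∘ b.
  by apply: mg; rewrite !comp_assoc -e -!comp_assoc eab.
have cmp : f ∘ (p ∘ a) = g ∘ (q ∘ a) by rewrite !comp_assoc e.
have [k [_ uk]] := u _ _ _ cmp.
by rewrite -(uk a) // -(uk b).
Qed.

Lemma regular_epi_epi (X Y Z : C) (e : Hom X Y) (g h : Hom Y Z) :
  regular_epi e -> g ∘ e = h ∘ e -> g = h.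
Proof.
move=> [W [p [q [epq u]]]] eq.
have c : (g ∘ e) ∘ p = (g ∘ e) ∘ q by rewrite -!comp_assoc epq.
have [k [_ uk]] := u _ _ c.
by rewrite -(uk g) // -(uk h).
Qed.

Lemma product_exists (R : regular) (X Y : C) : inhabited (product X Y).
Proof.
have [[I hI]] := reg_terminal R.
have [bX _] := hI X; have [bY _] := hI Y.
have [[P p q [_ u]]] := reg_pullback R bX bY.
constructor; refine {| prod_fst := p; prod_snd := q |} => T a b.
apply: u.
have [k [_ uk]] := hI T.
by rewrite -(uk (bX ∘ a)) // -(uk (bY ∘ b)).
Qed.

Definition inverse_image (R : regular) (X Y : C) (f : Hom X Y) (V : Sub Y) :
    Sub X :=
  let P := some (reg_pullback R f (sarr V)) in
  {| sarr := pb_fst P; smono := pullback_mono (pb_prop P) (@smono _ V) |}.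

End Notions.
Arguments regular C : clear implicits.
Arguments terminal_object C : clear implicits.

Record HeytingCategory := {
  hcat :> Category;
  hcat_regular : regular hcat;
  hcat_bottom : forall X : hcat, exists B : Sub X, forall U, sub_le B U;
  hcat_join : forall (X : hcat) (U V : Sub X), exists W : Sub X,
    forall Z, sub_le W Z <-> sub_le U Z /\ sub_le V Z;
  hcat_forall : forall (X Y : hcat) (f : Hom X Y) (V : Sub X),
    exists W : Sub Y, forall Z,
      sub_le Z W <-> sub_le (inverse_image hcat_regular f Z) V
}.

(** * Internal language

    A formula in context [X] is interpreted by a subobject of [X], a partial
    term by a partial map out of [X]. *)

Section Internal.
Context {H : HeytingCategory}.
Implicit Types X Y Z T : H.

Definition one : H := term_obj (some (reg_terminal (hcat_regular H))).
Definition bang X : Hom X one :=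
  proj1_sig (constructive_indefinite_description _
    (term_prop (some (reg_terminal (hcat_regular H))) X)).

Definition chosen_prod X Y : product X Y :=
  some (product_exists (hcat_regular H) X Y).
Definition prod X Y : H := prod_obj (chosen_prod X Y).
Definition pr1 {X Y} : Hom (prod X Y) X := prod_fst (chosen_prod X Y).
Definition pr2 {X Y} : Hom (prod X Y) Y := prod_snd (chosen_prod X Y).
Definition pair {T X Y} (a : Hom T X) (b : Hom T Y) : Hom T (prod X Y) :=
  proj1_sig (constructive_indefinite_description _
    (prod_prop (chosen_prod X Y) a b)).

Definition top X : Sub X := {| sarr := idm X; smono := @mono_id _ X |}.

Definition sub_comp X (U : Sub X) (V : Sub (sdom U)) : Sub X :=
  {| sarr := sarr U ∘ sarr V; smono := mono_comp (@smono _ _ U) (@smono _ _ V) |}.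

Definition inv X Y (f : Hom X Y) (V : Sub Y) : Sub X :=
  inverse_image (hcat_regular H) f V.
Definition inv_proj X Y (f : Hom X Y) (V : Sub Y) :
    Hom (sdom (inv f V)) (sdom V) :=
  pb_snd (some (reg_pullback (hcat_regular H) f (sarr V))).

Definition meet X (U V : Sub X) : Sub X := sub_comp (inv (sarr U) V).

Definition exim X Y (f : Hom X Y) (U : Sub X) : Sub Y :=
  im_sub (some (reg_image (hcat_regular H) (f ∘ sarr U))).

Definition univ X Y (f : Hom X Y) (V : Sub X) : Sub Y :=
  proj1_sig (constructive_indefinite_description _ (hcat_forall f V)).

Definition imp X (U V : Sub X) : Sub X := univ (sarr U) (inv (sarr U) V).

(** A subobject [U] is inhabited if [U -> 1] is a regular epimorphism. *)
Definition inhabited_sub X (U : Sub X) : Prop := regular_epi (bang (sdom U)).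

Record PMap (X Y : H) := {
  pdom : Sub X;
  pmap : Hom (sdom pdom) Y
}.

(** [pval f t z]: on the generalized element [t], [f] is defined with
    value [z]. *)
Definition pval T X Y (f : PMap X Y) (t : Hom T X) (z : Hom T Y) : Prop :=
  exists d : Hom T (sdom (pdom f)), sarr (pdom f) ∘ d = t /\ pmap f ∘ d = z.

Definition total X Y (f : Hom X Y) : PMap X Y :=
  {| pdom := top X; pmap := f |}.

(** The subobject [{x | f x is defined and lies in R}]. *)
Definition pinv X Y (f : PMap X Y) (R : Sub Y) : Sub X :=
  sub_comp (inv (pmap f) R).

Definition pcomp X Y Z (g : PMap Y Z) (f : PMap X Y) : PMap X Z :=
  {| pdom := pinv f (pdom g); pmap := pmap g ∘ inv_proj (pmap f) (pdom g) |}.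

Definition ppair X Y Z (f : PMap X Y) (g : PMap X Z) : PMap X (prod Y Z) :=
  {| pdom := meet (pdom f) (pdom g);
     pmap := pair (pmap f ∘ sarr (inv (sarr (pdom f)) (pdom g)))
                  (pmap g ∘ inv_proj (sarr (pdom f)) (pdom g)) |}.

Lemma bang_unique X (f g : Hom X one) : f = g.
Proof.
have [k [_ uk]] := term_prop (some (reg_terminal (hcat_regular H))) X.
by rewrite -(uk f) // -(uk g).
Qed.

Lemma pr1_pair T X Y (a : Hom T X) (b : Hom T Y) : pr1 ∘ pair a b = a.
Proof. by rewrite /pair; case: constructive_indefinite_description => k [[]]. Qed.

Lemma pr2_pair T X Y (a : Hom T X) (b : Hom T Y) : pr2 ∘ pair a b = b.
Proof. by rewrite /pair; case: constructive_indefinite_description => k [[]]. Qed.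

Lemma prod_ext T X Y (k l : Hom T (prod X Y)) :
  pr1 ∘ k = pr1 ∘ l -> pr2 ∘ k = pr2 ∘ l -> k = l.
Proof.
move=> e1 e2.
have [m [_ u]] := prod_prop (chosen_prod X Y) (pr1 ∘ k) (pr2 ∘ k).
by rewrite -(u k) // -(u l).
Qed.

Lemma pair_comp T T' X Y (a : Hom T X) (b : Hom T Y) (k : Hom T' T) :
  pair a b ∘ k = pair (a ∘ k) (b ∘ k).
Proof. by apply: prod_ext; rewrite comp_assoc ?pr1_pair ?pr2_pair. Qed.

Lemma pair_eta T X Y (k : Hom T (prod X Y)) : pair (pr1 ∘ k) (pr2 ∘ k) = k.
Proof. by apply: prod_ext; rewrite ?pr1_pair ?pr2_pair. Qed.

Lemma mem_comp T T' X (t : Hom T X) (k : Hom T' T) (S : Sub X) :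
  mem t S -> mem (t ∘ k) S.
Proof. by move=> [l <-]; exists (l ∘ k); rewrite comp_assoc. Qed.

Lemma mem_le T X (t : Hom T X) (U V : Sub X) : sub_le U V -> mem t U -> mem t V.
Proof. by move=> le [k <-]; apply: mem_comp. Qed.

Lemma mem_local T T' X (e : Hom T' T) (t : Hom T X) (S : Sub X) :
  regular_epi e -> mem (t ∘ e) S -> mem t S.
Proof.
move=> he [k ek]; have [W [p [q [epq u]]]] := he.
have c : k ∘ p = k ∘ q.
  by apply: (@smono _ _ S); rewrite !comp_assoc ek -!comp_assoc epq.
have [l [el _]] := u _ _ c.
exists l; apply: (regular_epi_epi he).
by rewrite -comp_assoc el.
Qed.

Lemma inv_square X Y (f : Hom X Y) (V : Sub Y) :
  is_pullback f (sarr V) (sarr (inv f V)) (inv_proj f V).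
Proof. exact: pb_prop. Qed.

Lemma mem_inv T X Y (f : Hom X Y) (V : Sub Y) (t : Hom T X) :
  mem t (inv f V) <-> mem (f ∘ t) V.
Proof.
have [e u] := inv_square f V; split.
  by move=> [k <-]; exists (inv_proj f V ∘ k); rewrite !comp_assoc e.
move=> [k ek].
have [l [[l1 l2] _]] := u _ t k (eq_sym ek).
by exists l.
Qed.

Lemma mem_sub_comp T X (U : Sub X) (V : Sub (sdom U)) (t : Hom T X) :
  mem t (sub_comp V) <-> exists k : Hom T (sdom U), sarr U ∘ k = t /\ mem k V.
Proof.
split.
  move=> [k <-]; exists (sarr V ∘ k); split; first by rewrite comp_assoc.
  by exists k.
by move=> [_ [<- [l <-]]]; exists l; rewrite -comp_assoc.
Qed.

Lemma mem_meet T X (U V : Sub X) (t : Hom T X) :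
  mem t (meet U V) <-> mem t U /\ mem t V.
Proof.
rewrite mem_sub_comp; split.
  by move=> [k [<- /mem_inv m]]; split => //; exists k.
by move=> [[k <-] m]; exists k; split => //; apply/mem_inv.
Qed.

Lemma mem_exim T X Y (f : Hom X Y) (U : Sub X) (s : Hom T X) :
  mem s U -> mem (f ∘ s) (exim f U).
Proof.
move=> [k <-]; rewrite /exim.
set I := some (reg_image (hcat_regular H) (f ∘ sarr U)).
by exists (im_cover I ∘ k); rewrite !comp_assoc im_eq.
Qed.

Lemma mem_exim_elim T X Y (f : Hom X Y) (U : Sub X) (t : Hom T Y) :
  mem t (exim f U) -> exists T' (e : Hom T' T) (s : Hom T' X),
    regular_epi e /\ mem s U /\ f ∘ s = t ∘ e.
Proof.
rewrite /exim; set I := some (reg_image (hcat_regular H) (f ∘ sarr U)).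
move=> [k <-].
have [P] := reg_pullback (hcat_regular H) (im_cover I) k.
have hp := pb_prop P.
exists (pb_obj P), (pb_snd P), (sarr U ∘ pb_fst P); split.
  exact: (reg_stable (hcat_regular H) hp (im_regular I)).
split; first by exists (pb_fst P).
have [e _] := hp.
by rewrite -comp_assoc -e !comp_assoc im_eq.
Qed.

Lemma univ_adj X Y (f : Hom X Y) (V : Sub X) (Z : Sub Y) :
  sub_le Z (univ f V) <-> sub_le (inv f Z) V.
Proof. by rewrite /univ; case: constructive_indefinite_description => W. Qed.

Lemma mem_univ T X Y (f : Hom X Y) (V : Sub X) (s : Hom T X) :
  mem (f ∘ s) (univ f V) -> mem s V.
Proof.
move=> m; have c : sub_le (inv f (univ f V)) V.
  by apply/univ_adj; exists (idm _); rewrite comp_id_r.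
by apply: (mem_le c); apply/mem_inv.
Qed.

Lemma mem_imp T X (U V : Sub X) (t : Hom T X) :
  mem t (imp U V) -> mem t U -> mem t V.
Proof. by move=> m [k e]; move: m; rewrite -e => /mem_univ /mem_inv. Qed.

Lemma pval_dom T X Y (f : PMap X Y) (t : Hom T X) :
  mem t (pdom f) <-> exists z, pval f t z.
Proof.
split; first by move=> [k e]; exists (pmap f ∘ k), k.
by move=> [z [k [e _]]]; exists k.
Qed.

Lemma pval_fun T X Y (f : PMap X Y) (t : Hom T X) (z z' : Hom T Y) :
  pval f t z -> pval f t z' -> z = z'.
Proof.
move=> [k [e <-]] [k' [e' <-]].
by rewrite (_ : k = k') //; apply: (@smono _ _ (pdom f)); rewrite e e'.
Qed.

Lemma pval_comp T T' X Y (f : PMap X Y) (t : Hom T X) (z : Hom T Y)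
    (k : Hom T' T) : pval f t z -> pval f (t ∘ k) (z ∘ k).
Proof. by move=> [d [<- <-]]; exists (d ∘ k); rewrite !comp_assoc. Qed.

Lemma pval_local T T' X Y (f : PMap X Y) (t : Hom T X) (e : Hom T' T) z' :
  regular_epi e -> pval f (t ∘ e) z' -> exists z, pval f t z /\ z ∘ e = z'.
Proof.
move=> he p; have /(mem_local he) /pval_dom [z pz] : mem (t ∘ e) (pdom f).
  by apply/pval_dom; exists z'.
exists z; split => //; exact: pval_fun (pval_comp e pz) p.
Qed.

Lemma pval_total T X Y (f : Hom X Y) (t : Hom T X) (z : Hom T Y) :
  pval (total f) t z <-> z = f ∘ t.
Proof.
split; first by move=> [k [/= <- <-]]; rewrite comp_id_l.
by move=> ->; exists t; rewrite /= comp_id_l.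
Qed.

Lemma mem_pinv T X Y (f : PMap X Y) (R : Sub Y) (t : Hom T X) :
  mem t (pinv f R) <-> exists y, pval f t y /\ mem y R.
Proof.
rewrite mem_sub_comp; split.
  move=> [k [<- /mem_inv m]]; exists (pmap f ∘ k); split => //.
  by exists k.
by move=> [y [[k [<- <-]] m]]; exists k; split => //; apply/mem_inv.
Qed.

Lemma pval_pcomp T X Y Z (g : PMap Y Z) (f : PMap X Y) (t : Hom T X)
    (z : Hom T Z) :
  pval (pcomp g f) t z <-> exists y, pval f t y /\ pval g y z.
Proof.
have [sq u] := inv_square (pmap f) (pdom g); split.
  move=> [d [/= <- <-]].
  exists (pmap f ∘ (sarr (inv (pmap f) (pdom g)) ∘ d)); split.
    by exists (sarr (inv (pmap f) (pdom g)) ∘ d); rewrite !comp_assoc.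
  exists (inv_proj (pmap f) (pdom g) ∘ d).
  by rewrite !comp_assoc sq.
move=> [y [[k [<- e]] [d [e' <-]]]].
have c : pmap f ∘ k = sarr (pdom g) ∘ d by rewrite e e'.
have [l [[<- <-] _]] := u _ _ _ c.
by exists l; rewrite /= !comp_assoc.
Qed.

Lemma pval_ppair T X Y Z (f : PMap X Y) (g : PMap X Z) (t : Hom T X)
    (z : Hom T (prod Y Z)) :
  pval (ppair f g) t z <-> pval f t (pr1 ∘ z) /\ pval g t (pr2 ∘ z).
Proof.
have [sq u] := inv_square (sarr (pdom f)) (pdom g); split.
  move=> [d [/= <- <-]]; rewrite !comp_assoc pr1_pair pr2_pair; split.
    by exists (sarr (inv (sarr (pdom f)) (pdom g)) ∘ d); rewrite !comp_assoc.
  exists (inv_proj (sarr (pdom f)) (pdom g) ∘ d).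
  by rewrite !comp_assoc sq.
move=> [[k [e1 e2]] [l [e3 e4]]].
have c : sarr (pdom f) ∘ k = sarr (pdom g) ∘ l by rewrite e1 e3.
have [m [[h1 h2] _]] := u _ _ _ c.
exists m; rewrite /= -comp_assoc h1; split => //.
by rewrite pair_comp -!comp_assoc h1 h2 e2 e4 pair_eta.
Qed.

End Internal.

(** * Order partial applicative structures and filters *)

(** The axioms are Horn sequents, so they are stated for generalized
    elements. *)
Record OPAS (H : HeytingCategory) := {
  carrier :> H;
  le : Sub (prod carrier carrier);
  app : PMap (prod carrier carrier) carrier;
  le_refl : forall T (x : Hom T carrier), mem (pair x x) le;
  le_trans : forall T (x y z : Hom T carrier),
    mem (pair x y) le -> mem (pair y z) le -> mem (pair x z) le;
  app_mono : forall T (x y x' y' z' : Hom T carrier),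
    mem (pair x x') le -> mem (pair y y') le -> pval app (pair x' y') z' ->
    exists z, pval app (pair x y) z /\ mem (pair z z') le
}.

Section Realizability.
Context {H : HeytingCategory} (A : OPAS H).
Implicit Types X Y T : H.

(** [A^(n+1) = A^n * A], so the last coordinate is [pr2]. *)
Fixpoint pow (n : nat) : H :=
  match n with
  | O => one
  | S n => prod (pow n) A
  end.

Inductive projection : forall n, Hom (pow n) A -> Prop :=
| proj_last n : @projection (S n) pr2
| proj_prev n p : @projection n p -> @projection (S n) (p ∘ pr1).

Definition papp X (f g : PMap X A) : PMap X A := pcomp (app A) (ppair f g).

Inductive partial_combinatory n : PMap (pow n) A -> Prop :=
| pc_proj p : projection p -> partial_combinatory (total p)
| pc_app f g : partial_combinatory f -> partial_combinatory g ->
    partial_combinatory (papp f g).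

(** The partial map [(r, x_1, ..., x_n) |-> (((r x_1) x_2) ...) x_n]. *)
Fixpoint iter_app (n : nat) : PMap (prod A (pow n)) A :=
  match n with
  | O => total pr1
  | S n => papp (pcomp (iter_app n) (total (pair pr1 (pr1 ∘ pr2))))
                (total (pr2 ∘ pr2))
  end.

(** The subobject [{x | f x and g x are defined and f x <= g x}]. *)
Definition ple X (f g : PMap X A) : Sub X := pinv (ppair f g) (le A).

Definition realizers n (f : PMap (pow (S n)) A) : Sub A :=
  meet (univ pr1 (pdom (iter_app n)))
       (univ pr1 (imp (inv pr2 (pdom f))
                      (ple (iter_app (S n)) (pcomp f (total pr2))))).

Definition downset (U : Sub A) : Prop :=
  forall T (x y : Hom T A), mem (pair x y) (le A) -> mem y U -> mem x U.

Definition box (U V : Sub A) : Sub (prod A A) := meet (inv pr1 U) (inv pr2 V).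

Definition applicable (U V : Sub A) : Prop := sub_le (box U V) (pdom (app A)).

Definition dapp (U V : Sub A) : Sub A :=
  exim (pr1 : Hom (prod A (prod A A)) A)
    (meet (inv pr2 (box U V)) (ple (total pr1) (pcomp (app A) (total pr2)))).

Record external_filter := {
  filt :> Sub A -> Prop;
  filt_downset : forall U, filt U -> downset U;
  filt_up : forall U V, filt U -> downset V -> sub_le U V -> filt V;
  filt_app : forall U V, filt U -> filt V -> applicable U V -> filt (dapp U V)
}.

Definition combinatory_complete (phi : external_filter) : Prop :=
  forall n (f : PMap (pow (S n)) A), partial_combinatory f -> phi (realizers f).

Definition family_downset X (Y : Sub (prod A X)) : Prop :=
  forall T (a b : Hom T A) (x : Hom T X),
    mem (pair a b) (le A) -> mem (pair b x) Y -> mem (pair a x) Y.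

Record family := {
  base : H;
  fib : Sub (prod A base);
  fib_downset : family_downset fib
}.

Definition tracks (P Q : family) (U : Sub A) (f : Hom (base P) (base Q)) :
    Prop :=
  forall T (u a : Hom T A) (x : Hom T (base P)),
    mem u U -> mem (pair a x) (fib P) ->
    exists b, pval (app A) (pair u a) b /\ mem (pair b (f ∘ x)) (fib Q).

Definition tracked (phi : external_filter) (P Q : family)
    (f : Hom (base P) (base Q)) : Prop :=
  exists U, phi U /\ tracks U f.

Lemma pval_papp T X (f g : PMap X A) (t : Hom T X) (z : Hom T A) :
  pval (papp f g) t z <->
  exists x y, pval f t x /\ pval g t y /\ pval (app A) (pair x y) z.
Proof.
rewrite pval_pcomp; split.
  move=> [y [/pval_ppair [h1 h2] h3]].
  by exists (pr1 ∘ y), (pr2 ∘ y); rewrite pair_eta.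
move=> [x [y [h1 [h2 h3]]]]; exists (pair x y); split => //.
by apply/pval_ppair; rewrite pr1_pair pr2_pair.
Qed.

Lemma mem_ple T X (f g : PMap X A) (t : Hom T X) :
  mem t (ple f g) <->
  exists x y, pval f t x /\ pval g t y /\ mem (pair x y) (le A).
Proof.
rewrite mem_pinv; split.
  move=> [y [/pval_ppair [h1 h2] h3]].
  by exists (pr1 ∘ y), (pr2 ∘ y); rewrite pair_eta.
move=> [x [y [h1 [h2 h3]]]]; exists (pair x y); split => //.
by apply/pval_ppair; rewrite pr1_pair pr2_pair.
Qed.

Lemma mem_box T (U V : Sub A) (x y : Hom T A) :
  mem (pair x y) (box U V) <-> mem x U /\ mem y V.
Proof. by rewrite mem_meet !mem_inv pr1_pair pr2_pair. Qed.

Lemma applicable_intro (U V : Sub A) :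
  (forall T (x y : Hom T A), mem x U -> mem y V ->
     exists z, pval (app A) (pair x y) z) -> applicable U V.
Proof.
move=> h; rewrite /applicable /sub_le -(pair_eta (sarr (box U V))).
have /mem_box [m1 m2] : mem (pair (pr1 ∘ sarr (box U V)) (pr2 ∘ sarr (box U V)))
    (box U V).
  by rewrite pair_eta; exists (idm _); rewrite comp_id_r.
exact/pval_dom/h.
Qed.

Lemma mem_dapp_elim T (U V : Sub A) (z : Hom T A) :
  mem z (dapp U V) -> exists T' (e : Hom T' T) (x y w : Hom T' A),
    regular_epi e /\ mem x U /\ mem y V /\ pval (app A) (pair x y) w /\
    mem (pair (z ∘ e) w) (le A).
Proof.
move=> /mem_exim_elim [T' [e [s [he [/mem_meet [/mem_inv m1 /mem_ple] h]]]]].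
move=> es; case: h => [a [w [/pval_total ea [/pval_pcomp [p [ep hp]] m2]]]].
move/pval_total: ep => ep.
have /mem_box [mU mV] : mem (pair (pr1 ∘ (pr2 ∘ s)) (pr2 ∘ (pr2 ∘ s))) (box U V).
  by rewrite pair_eta.
exists T', e, (pr1 ∘ (pr2 ∘ s)), (pr2 ∘ (pr2 ∘ s)), w.
by rewrite pair_eta -es -ea; subst p.
Qed.

Lemma mem_realizers T n (f : PMap (pow (S n)) A) (r : Hom T A) :
  mem r (realizers f) ->
  (forall x : Hom T (pow n), exists z, pval (iter_app n) (pair r x) z) /\
  (forall (y : Hom T (pow (S n))) v, pval f y v ->
     exists z, pval (iter_app (S n)) (pair r y) z /\ mem (pair z v) (le A)).
Proof.
move=> /mem_meet [m1 m2]; split.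
  move=> x; apply/pval_dom; apply: (mem_univ (f := pr1)).
  by rewrite pr1_pair.
move=> y v hv.
have m3 : mem (pair r y) (imp (inv pr2 (pdom f))
    (ple (iter_app (S n)) (pcomp f (total pr2)))).
  by apply: (mem_univ (f := pr1)); rewrite pr1_pair.
have m4 : mem (pair r y) (inv pr2 (pdom f)).
  by apply/mem_inv; rewrite pr2_pair; apply/pval_dom; exists v.
have /mem_ple [z [v' [hz [hv' m]]]] := mem_imp m3 m4.
exists z; split => //.
move/pval_pcomp: hv' => [y' [/pval_total ey hv']].
by move: hv'; rewrite ey pr2_pair => hv'; rewrite (pval_fun hv hv').
Qed.

Lemma iter_app_S T n (r x : Hom T A) (xs : Hom T (pow n)) z :
  pval (iter_app (S n)) (pair r (pair xs x)) z <->
  exists w, pval (iter_app n) (pair r xs) w /\ pval (app A) (pair w x) z.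
Proof.
rewrite /= pval_papp; split.
  move=> [w [y [/pval_pcomp [p [/pval_total ->]] ]]].
  rewrite pair_comp -comp_assoc pr1_pair pr2_pair pr1_pair => h1.
  move=> [/pval_total ->]; rewrite -comp_assoc !pr2_pair => h2.
  by exists w.
move=> [w [h1 h2]]; exists w, x; split.
  apply/pval_pcomp; exists (pair r xs); split => //; apply/pval_total.
  by rewrite pair_comp -comp_assoc pr1_pair pr2_pair pr1_pair.
by split => //; apply/pval_total; rewrite -comp_assoc !pr2_pair.
Qed.

Lemma iter_app_O T (r : Hom T A) (x : Hom T (pow 0)) z :
  pval (iter_app 0) (pair r x) z <-> z = r.
Proof. by rewrite /= pval_total pr1_pair. Qed.

Section Category.
Variables (phi : external_filter) (cc : combinatory_complete phi).

Lemma tracked_id (P : family) : tracked phi (P := P) (Q := P) (idm (base P)).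
Proof.
exists (realizers (n := 0) (total pr2)); split.
  exact/cc/pc_proj/proj_last.
move=> T u a x /mem_realizers [_ h] m.
have [//|z [hz le_z]] := h (pair (bang T) a) a.
  by apply/pval_total; rewrite pr2_pair.
have /iter_app_S [w [/iter_app_O -> hw]] := hz.
exists z; split => //; rewrite comp_id_l.
exact: fib_downset le_z m.
Qed.

Definition comp_code : PMap (pow 3) A :=
  papp (total (pr2 ∘ pr1 ∘ pr1)) (papp (total (pr2 ∘ pr1)) (total pr2)).

Lemma comp_code_pc : partial_combinatory comp_code.
Proof.
apply: pc_app; first by apply/pc_proj/proj_prev/proj_prev/proj_last.
apply: pc_app; first by apply/pc_proj/proj_prev/proj_last.
exact/pc_proj/proj_last.
Qed.

Lemma tracked_comp (P Q R : family) (g : Hom (base Q) (base R))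
    (f : Hom (base P) (base Q)) :
  tracked phi (P := Q) (Q := R) g -> tracked phi (P := P) (Q := Q) f ->
  tracked phi (P := P) (Q := R) (g ∘ f).
Proof.
move=> [V [pV tV]] [U [pU tU]].
set B := realizers comp_code.
have pB : phi B by exact/cc/comp_code_pc.
have app2 T (b v u : Hom T A) : mem b B ->
    exists bv bvu, pval (app A) (pair b v) bv /\ pval (app A) (pair bv u) bvu.
  move=> /mem_realizers [h _].
  have [z] := h (pair (pair (bang T) v) u).
  move=> /iter_app_S [bv [/iter_app_S [b' [/iter_app_O -> h1]] h2]].
  by exists bv, z.
have aBV : applicable B V.
  apply: applicable_intro => T b v mb _.
  by have [bv [_ [h _]]] := app2 _ b v v mb; exists bv.
have pBV : phi (dapp B V) by exact: filt_app.
have aBVU : applicable (dapp B V) U.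
  apply: applicable_intro => T w u /mem_dapp_elim.
  move=> [T' [e [b [v [bv [he [mb [mv [hbv le_w]]]]]]]]] mu.
  have [bv' [bvu [h1 h2]]] := app2 _ b v (u ∘ e) mb.
  rewrite (pval_fun h1 hbv) in h2.
  have [z [hz _]] := app_mono le_w (le_refl (u ∘ e)) h2.
  rewrite -pair_comp in hz.
  by have [z' [hz' _]] := pval_local he hz; exists z'.
exists (dapp (dapp B V) U); split; first exact: filt_app.
move=> T w a x mw ma.
suff [T' [e [z [he [hz mz]]]]] : exists T' (e : Hom T' T) z,
    regular_epi e /\ pval (app A) (pair w a ∘ e) z /\
    mem (pair z (g ∘ f ∘ x ∘ e)) (fib R).
  have [z0 [hz0 ez]] := pval_local he hz.
  exists z0; split => //; apply: (mem_local he).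
  by rewrite pair_comp ez.
move: mw => /mem_dapp_elim [T1 [e1 [c [u [cu [he1 [mc [mu [hcu le_w]]]]]]]]].
move: mc => /mem_dapp_elim [T2 [e2 [b [v [bv [he2 [mb [mv [hbv le_c]]]]]]]]].
suff [z [hz mz]] : exists z, pval (app A) (pair w a ∘ e1 ∘ e2) z /\
    mem (pair z (g ∘ f ∘ x ∘ e1 ∘ e2)) (fib R).
  have /(pval_local he2) [z1 [hz1 ez1]] := hz.
  exists T1, e1, z1; split => //; split => //; apply: (mem_local he2).
  by rewrite pair_comp ez1.
have ma2 : mem (pair (a ∘ e1 ∘ e2) (x ∘ e1 ∘ e2)) (fib P).
  by rewrite -!pair_comp; do 2!apply: mem_comp.
have [ua [hua mua]] := tU _ _ _ _ (mem_comp e2 mu) ma2.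
have [vua [hvua mvua]] := tV _ _ _ _ mv mua.
have [_ hB] := mem_realizers mb.
have [|z [hz le_z]] :=
  hB (pair (pair (pair (bang T2) v) (u ∘ e2)) (a ∘ e1 ∘ e2)) vua.
  apply/pval_papp; exists v, ua; split.
    by apply/pval_total; rewrite -!comp_assoc !pr1_pair pr2_pair.
  split => //; apply/pval_papp; exists (u ∘ e2), (a ∘ e1 ∘ e2); split.
    by apply/pval_total; rewrite -!comp_assoc !pr1_pair pr2_pair.
  by split => //; apply/pval_total; rewrite pr2_pair.
move: hz => /iter_app_S [bvu [/iter_app_S [bv' [/iter_app_S [b' [/iter_app_O -> h1]] h2]] h3]].
rewrite (pval_fun h1 hbv) in h2.
have [cu' [hcu' le_cu]] := app_mono le_c (le_refl (u ∘ e2)) h2.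
have /(pval_fun hcu') ecu : pval (app A) (pair (c ∘ e2) (u ∘ e2)) (cu ∘ e2).
  by rewrite -pair_comp; apply: pval_comp.
have le_w2 : mem (pair (w ∘ e1 ∘ e2) bvu) (le A).
  apply: le_trans le_cu; rewrite ecu -pair_comp.
  exact: mem_comp.
have [y [hy le_y]] := app_mono le_w2 (le_refl (a ∘ e1 ∘ e2)) h3.
exists y; split; first by rewrite !pair_comp.
apply: (fib_downset (le_trans le_y le_z)).
by rewrite -!comp_assoc in mvua *.
Qed.

(** The total category of the realizability fibration; its morphisms are
    the tracked morphisms of the base category. *)
Definition DA_hom (P Q : family) : Type :=
  {f : Hom (base P) (base Q) | tracked phi f}.

Lemma DA_hom_eq (P Q : family) (f g : DA_hom P Q) :
  proj1_sig f = proj1_sig g -> f = g.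
Proof.
case: f g => [f hf] [g hg] /= e; subst g.
by rewrite (proof_irrelevance _ hf hg).
Qed.

Definition DA_comp (P Q R : family) (g : DA_hom Q R) (f : DA_hom P Q) :
    DA_hom P R :=
  exist _ (proj1_sig g ∘ proj1_sig f)
    (tracked_comp (proj2_sig g) (proj2_sig f)).

Definition DA_cat : Category.
Proof.
refine {| Obj := family; Hom := DA_hom;
          idm P := exist _ (idm (base P)) (tracked_id P); comp := DA_comp |}.
- by move=> P Q f; apply: DA_hom_eq; rewrite /= comp_id_l.
- by move=> P Q f; apply: DA_hom_eq; rewrite /= comp_id_r.
- by move=> P Q R S h g f; apply: DA_hom_eq; rewrite /= comp_assoc.
Defined.

Definition DA_fibration : Functor DA_cat H.
Proof.
refine {| fobj := base : DA_cat -> H;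
          fmap P Q (f : @Hom DA_cat P Q) := proj1_sig f |}.
- by [].
- by [].
Defined.

(** [{x | exists a, (a, x) in Y}] *)
Definition Sigma (P : DA_cat) : Sub (DA_fibration P) := exim pr2 (fib P).

End Category.
End Realizability.
Arguments Sigma {H A phi} cc P.
Arguments DA_fibration {H A phi} cc.

(** * Subfunctors and regular functors *)

Section Subfunctors.
Context {C D : Category} (F : Functor C D) (S : forall X : C, Sub (F X)).

Definition defines_subfunctor : Prop :=
  forall (X Y : C) (f : Hom X Y),
    exists g : Hom (sdom (S X)) (sdom (S Y)),
      sarr (S Y) ∘ g = fmap F f ∘ sarr (S X).

Definition subfunctor (h : defines_subfunctor) : Functor C D.
Proof.
refine {| fobj X := sdom (S X);
          fmap X Y f := proj1_sig (constructive_indefinite_description _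
                                     (h X Y f)) |}.
- move=> X; case: constructive_indefinite_description => g /= e.
  by apply: (@smono _ _ (S X)); rewrite e fmap_id comp_id_l comp_id_r.
- move=> X Y Z g f.
  do 3!case: constructive_indefinite_description => ? /=.
  move=> ef eg egf; apply: (@smono _ _ (S Z)).
  by rewrite egf comp_assoc eg -comp_assoc ef fmap_comp comp_assoc.
Defined.

End Subfunctors.

Record regular_functor (C D : Category) (F : Functor C D) : Prop := {
  rf_source : regular C;
  rf_target : regular D;
  rf_terminal : forall T : C, is_terminal T -> is_terminal (F T);
  rf_pullback : forall (P X Y Z : C) (f : Hom X Z) (g : Hom Y Z)
      (p : Hom P X) (q : Hom P Y),
    is_pullback f g p q ->
    is_pullback (fmap F f) (fmap F g) (fmap F p) (fmap F q);
  rf_regular_epi : forall (X Y : C) (e : Hom X Y),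
    regular_epi e -> regular_epi (fmap F e)
}.

(** * Categories of fractions *)

(** The category of fractions [C[W^-1]] has the objects of [C]; its morphisms
    are formal composites of morphisms of [C] and formal inverses of elements
    of [W], modulo the congruence making [fr_in] a functor and [fr_inv] its
    inverse on [W]. *)
Section Fractions.
Context {C : Category} (W : forall X Y : C, Hom X Y -> Prop).

Inductive frac : C -> C -> Type :=
| fr_in X Y (f : Hom X Y) : frac X Y
| fr_inv X Y (w : Hom X Y) (hw : W w) : frac Y X
| fr_comp X Y Z (b : frac Y Z) (a : frac X Y) : frac X Z.

Inductive frac_eq : forall X Y, frac X Y -> frac X Y -> Prop :=
| fe_refl X Y (a : frac X Y) : frac_eq a a
| fe_sym X Y (a b : frac X Y) : frac_eq a b -> frac_eq b a
| fe_trans X Y (a b c : frac X Y) : frac_eq a b -> frac_eq b c -> frac_eq a c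
| fe_comp X Y Z (b b' : frac Y Z) (a a' : frac X Y) :
    frac_eq b b' -> frac_eq a a' -> frac_eq (fr_comp b a) (fr_comp b' a')
| fe_id_l X Y (a : frac X Y) : frac_eq (fr_comp (fr_in (idm Y)) a) a
| fe_id_r X Y (a : frac X Y) : frac_eq (fr_comp a (fr_in (idm X))) a
| fe_assoc X Y Z T (c : frac Z T) (b : frac Y Z) (a : frac X Y) :
    frac_eq (fr_comp c (fr_comp b a)) (fr_comp (fr_comp c b) a)
| fe_in X Y Z (g : Hom Y Z) (f : Hom X Y) :
    frac_eq (fr_in (g ∘ f)) (fr_comp (fr_in g) (fr_in f))
| fe_inv_l X Y (w : Hom X Y) (hw : W w) :
    frac_eq (fr_comp (fr_inv hw) (fr_in w)) (fr_in (idm X))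
| fe_inv_r X Y (w : Hom X Y) (hw : W w) :
    frac_eq (fr_comp (fr_in w) (fr_inv hw)) (fr_in (idm Y)).

Definition frac_hom (X Y : C) : Type :=
  {E : frac X Y -> Prop | exists a, E = frac_eq a}.

Definition frac_class X Y (a : frac X Y) : frac_hom X Y :=
  exist _ (frac_eq a) (ex_intro _ a eq_refl).

Definition frac_repr X Y (m : frac_hom X Y) : frac X Y :=
  proj1_sig (constructive_indefinite_description _ (proj2_sig m)).

Lemma frac_class_eq X Y (a b : frac X Y) :
  frac_eq a b <-> frac_class a = frac_class b.
Proof.
split=> [h|/(f_equal (@proj1_sig _ _)) /= ->]; last exact: fe_refl.
rewrite /frac_class; have e : frac_eq a = frac_eq b.
  apply: functional_extensionality => c; apply: propositional_extensionality.
  by split; apply: fe_trans => //; apply: fe_sym.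
move: (ex_intro _ a _) (ex_intro _ b _); rewrite e => p q.
by rewrite (proof_irrelevance _ p q).
Qed.

Lemma frac_reprK X Y (m : frac_hom X Y) : frac_class (frac_repr m) = m.
Proof.
rewrite /frac_repr; case: m => [E hE] /=.
case: constructive_indefinite_description => a /= e; subst E.
by rewrite /frac_class (proof_irrelevance _ (ex_intro _ a _) hE).
Qed.

Lemma frac_repr_class X Y (a : frac X Y) : frac_eq (frac_repr (frac_class a)) a.
Proof. by apply/frac_class_eq; rewrite frac_reprK. Qed.

Definition frac_cat : Category.
Proof.
refine {| Obj := C; Hom := frac_hom; idm X := frac_class (fr_in (idm X));
          comp X Y Z b a :=
            frac_class (fr_comp (frac_repr b) (frac_repr a)) |}.
- move=> X Y a; rewrite -[RHS]frac_reprK; apply/frac_class_eq.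
  apply: fe_trans (fe_id_l _); apply: fe_comp (fe_refl _).
  exact: frac_repr_class.
- move=> X Y a; rewrite -[RHS]frac_reprK; apply/frac_class_eq.
  apply: fe_trans (fe_id_r _); apply: fe_comp; first exact: fe_refl.
  exact: frac_repr_class.
- move=> X Y Z T c b a; apply/frac_class_eq.
  apply: fe_trans (fe_comp (fe_refl _) (frac_repr_class _)) _.
  apply: fe_trans (fe_assoc _ _ _) _.
  by apply: fe_comp (fe_refl _); apply/fe_sym/frac_repr_class.
Defined.

Definition frac_functor : Functor C frac_cat.
Proof.
refine {| fobj := (fun X => X) : C -> frac_cat;
          fmap X Y f := frac_class (fr_in f) : @Hom frac_cat X Y |}.
- by [].
- move=> X Y Z g f; apply/frac_class_eq.
  apply: fe_trans (fe_in _ _) _.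
  by apply: fe_comp; apply/fe_sym/frac_repr_class.
Defined.

End Fractions.

Section Asm.
Context {C D : Category} (F : Functor C D).

Definition supine (X Y : C) (f : Hom X Y) : Prop :=
  forall (Z : C) (g : Hom X Z) (h : Hom (F Y) (F Z)),
    fmap F g = h ∘ fmap F f ->
    exists! k : Hom Y Z, fmap F k = h /\ k ∘ f = g.

Definition supine_mono (X Y : C) (f : Hom X Y) : Prop := mono f /\ supine f.

Definition Asm : Category := frac_cat supine_mono.
Definition Asm_functor : Functor C Asm := frac_functor supine_mono.

End Asm.

(** [S] factors through [Q] up to isomorphism, and the factorization is unique
    up to an isomorphism compatible with the chosen isomorphisms. *)
Definition factors_uniquely (C L D : Category) (Q : Functor C L)
    (S : Functor C D) : Prop :=
  exists (G : Functor L D) (alpha : NatIso (functor_comp G Q) S),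
    forall (G' : Functor L D) (alpha' : NatIso (functor_comp G' Q) S),
      exists beta : NatIso G' G,
        forall X : C, alpha X ∘ beta (Q X) = alpha' X.

(* Main.v *)
(** If a tracker [U] of [f] is inhabited, then locally some [u] in [U] sends a
    realizer of [x] to a realizer of [f x], so [f] preserves [Sigma];
    conversely, the constant code gives for each [U] in the filter a tracker of
    the identity of [1] from the inhabited family [A] to the family [U].

    In the total category, limits are computed in the base with pairing of
    realizers, and a regular epimorphism is a regular epimorphism [f] of the
    base whose codomain is tracked into the direct image of its domain along
    [f]. The latter property alone makes the restriction of [f] to [Sigma]
    locally surjective. Supine morphisms have it too, so [Sigma] inverts the
    supine monomorphisms, and extends to the category of fractions. *)

Require Import Defs.
From Stdlib Require Import ssreflect ClassicalEpsilon.
From Stdlib Require List.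

Local Open Scope list_scope.

Set Implicit Arguments.
Unset Strict Implicit.
Unset Printing Implicit Defensive.

(** * Invariance of limits and regular epimorphisms under isomorphism *)

Section Categories.
Context {C : Category}.

Lemma is_coequalizer_iso (X Y Q Q' : C) (p q : Hom X Y) (e : Hom Y Q)
    (i : Hom Q Q') :
  is_coequalizer p q e -> is_iso i -> is_coequalizer p q (i ∘ e).
Proof.
move=> [epq u] [j [ji ij]]; split; first by rewrite -!comp_assoc epq.
move=> T t /u [k [ek uk]]; exists (k ∘ j); split.
  by rewrite -comp_assoc (comp_assoc j) ji comp_id_l.
move=> k' ek'; rewrite (uk (k' ∘ i)); first by rewrite -comp_assoc.
by rewrite -comp_assoc ij comp_id_r.
Qed.

Lemma regular_epi_iso (X Y Y' : C) (e : Hom X Y) (i : Hom Y Y') :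
  regular_epi e -> is_iso i -> regular_epi (i ∘ e).
Proof.
move=> [Z [p [q h]]] hi; exists Z, p, q; exact: is_coequalizer_iso.
Qed.

Lemma regular_epi_iso_r (X X' Y : C) (e : Hom X Y) (i : Hom X' X) :
  regular_epi e -> is_iso i -> regular_epi (e ∘ i).
Proof.
move=> [Z [p [q [epq u]]]] [j [ji ij]]; exists Z, (j ∘ p), (j ∘ q); split.
  rewrite !comp_assoc -!(comp_assoc e) ij !comp_assoc -!(comp_assoc e).
  by rewrite !comp_id_l.
move=> T t; rewrite !comp_assoc => /u [k [ek uk]]; exists k; split.
  by rewrite comp_assoc ek -comp_assoc ji comp_id_r.
by move=> k' ek'; apply: uk; rewrite -ek' -!comp_assoc ij comp_id_r.
Qed.

Lemma regular_epi_id (X : C) : regular_epi (idm X).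
Proof.
exists X, (idm X), (idm X); split=> // T t _; exists t; split.
  exact: comp_id_r.
by move=> k <-; rewrite comp_id_r.
Qed.

Lemma split_mono_iso (X Y : C) (m : Hom X Y) (s : Hom Y X) :
  mono m -> m ∘ s = idm Y -> is_iso m.
Proof.
move=> mm e; exists s; split => //; apply: mm.
by rewrite comp_assoc e comp_id_l comp_id_r.
Qed.

Lemma is_pullback_iso (P P' X Y Z : C) (f : Hom X Z) (g : Hom Y Z)
    (p : Hom P X) (q : Hom P Y) (i : Hom P' P) :
  is_pullback f g p q -> is_iso i -> is_pullback f g (p ∘ i) (q ∘ i).
Proof.
move=> [e u] [j [ji ij]]; split; first by rewrite !comp_assoc e.
move=> T a b /u [k [[ka kb] uk]]; exists (j ∘ k); split.
  by rewrite -!comp_assoc (comp_assoc i) ij comp_id_l.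
move=> k' [ka' kb']; rewrite (uk (i ∘ k')); first by rewrite !comp_assoc.
by rewrite comp_assoc ji comp_id_l.
Qed.

Lemma is_pullback_unique (P P' X Y Z : C) (f : Hom X Z) (g : Hom Y Z)
    (p : Hom P X) (q : Hom P Y) (p' : Hom P' X) (q' : Hom P' Y) :
  is_pullback f g p q -> is_pullback f g p' q' ->
  exists i : Hom P' P, is_iso i /\ p ∘ i = p' /\ q ∘ i = q'.
Proof.
move=> [e u] [e' u'].
have [i [[pi qi] _]] := u _ _ _ e'.
have [j [[pj qj] _]] := u' _ _ _ e.
exists i; split => //; exists j; split.
  have [k [_ uk]] := u' _ _ _ e'; rewrite -(uk (idm _)) ?comp_id_r //.
  by apply/eq_sym/uk; rewrite !comp_assoc pj qj.
have [k [_ uk]] := u _ _ _ e; rewrite -(uk (idm _)) ?comp_id_r //.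
by apply/eq_sym/uk; rewrite !comp_assoc pi qi.
Qed.

Lemma is_terminal_iso (T T' : C) (i : Hom T T') :
  is_terminal T -> is_iso i -> is_terminal T'.
Proof.
move=> hT [j [ji ij]] X; have [k [_ uk]] := hT X.
exists (i ∘ k); split => // k' _.
by rewrite (uk (j ∘ k')) // comp_assoc ij comp_id_l.
Qed.

Lemma is_terminal_unique (T T' : C) :
  is_terminal T -> is_terminal T' -> exists i : Hom T T', is_iso i.
Proof.
move=> hT hT'; have [i _] := hT' T; have [j _] := hT T'.
exists i, j; split.
  have [k [_ uk]] := hT T; by rewrite -(uk (idm T)) // -(uk (j ∘ i)).
have [k [_ uk]] := hT' T'; by rewrite -(uk (idm T')) // -(uk (i ∘ j)).
Qed.

Lemma fmap_iso (E : Category) (F : Functor C E) (X Y : C) (i : Hom X Y) :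
  is_iso i -> is_iso (fmap F i).
Proof.
by move=> [j [ji ij]]; exists (fmap F j); rewrite -!fmap_comp ji ij !fmap_id.
Qed.

End Categories.

(** * Regular epimorphisms in a Heyting category *)

Section Covers.
Context {H : HeytingCategory}.
Implicit Types X Y Z T : H.

(** Membership is local along covers: after composition with [f], the identity of [Y] lies in the
    subobject [f], so it already does, and this yields a section of a monomorphism. *)
Lemma mono_regular_epi_iso X Y (f : Hom X Y) :
  mono f -> regular_epi f -> is_iso f.
Proof.
move=> mf hf; have [k ek] : mem (idm Y) {| sarr := f; smono := mf |}.
  by apply: (mem_local hf); exists (idm X); rewrite comp_id_l comp_id_r.
exact: split_mono_iso ek.
Qed.


(** The identity of [Y] lies in the image of [f] locally along [f ∘ s], so the image is all of [Y].
    The same argument gives closure under composition. *)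
Lemma regular_epi_cancel X Y T (f : Hom X Y) (s : Hom T X) :
  regular_epi (f ∘ s) -> regular_epi f.
Proof.
move=> h; have [[M c hc ef]] := reg_image (hcat_regular H) f.
rewrite -ef; apply: regular_epi_iso => //.
have [k ek] : mem (idm Y) M; last exact: split_mono_iso (@smono _ _ M) ek.
apply: (mem_local h); rewrite comp_id_l -ef.
by exists (c ∘ s); rewrite comp_assoc.
Qed.

Lemma regular_epi_comp X Y Z (g : Hom Y Z) (f : Hom X Y) :
  regular_epi g -> regular_epi f -> regular_epi (g ∘ f).
Proof.
move=> hg hf; have [[M c hc ef]] := reg_image (hcat_regular H) (g ∘ f).
rewrite -ef; apply: regular_epi_iso => //.
have [k ek] : mem (idm Z) M; last exact: split_mono_iso (@smono _ _ M) ek.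
apply: (mem_local hg); apply: (mem_local hf); rewrite comp_id_l -ef.
by exists c.
Qed.

Lemma regular_epi_pullback X Y T (f : Hom X Y) (t : Hom T Y) :
  regular_epi f -> exists T' (e : Hom T' T) (s : Hom T' X),
    regular_epi e /\ f ∘ s = t ∘ e.
Proof.
move=> hf; have [[P p q h]] := reg_pullback (hcat_regular H) f t.
exists P, q, p; split; first exact: reg_stable (hcat_regular H) _ _ _ _ _ _ _ _ h hf.
by case: h.
Qed.

(** With [inhabited_intro], the Kripke-Joyal reading of inhabitedness: elements are available at the
    price of a cover, which [mem_local] and [pval_local] remove afterwards. *)
Lemma inhabited_local X (U : Sub X) T : inhabited_sub U ->
  exists T' (e : Hom T' T) (x : Hom T' X), regular_epi e /\ mem x U.
Proof.
move=> hU; have [T' [e [s [he _]]]] := regular_epi_pullback (bang T) hU.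
by exists T', e, (sarr U ∘ s); split => //; exists s.
Qed.

Lemma inhabited_intro X (U : Sub X) T (e : Hom T one) (x : Hom T X) :
  regular_epi e -> mem x U -> inhabited_sub U.
Proof.
move=> he [k _]; apply: (@regular_epi_cancel _ _ _ _ k).
by rewrite (bang_unique (_ ∘ k) e).
Qed.

End Covers.

(** * Iterated application inside the filter and tracking by combinatory codes *)

Section Codes.
Context {H : HeytingCategory} {A : OPAS H}.
Implicit Types X Y Z T : H.

Fixpoint boxes (l : list (Sub A)) : Sub (pow A (length l)) :=
  match l with
  | nil => top one
  | U :: l => meet (inv pr1 (boxes l)) (inv pr2 U)
  end.

Fixpoint dapps (B : Sub A) (l : list (Sub A)) : Sub A :=
  match l with
  | nil => B
  | U :: l => dapp (dapps B l) U
  end.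

Lemma mem_boxes_cons T (U : Sub A) l (xs : Hom T (pow A (length l)))
    (x : Hom T A) :
  mem (pair xs x : Hom T (pow A (length (U :: l)))) (boxes (U :: l)) <->
  mem xs (boxes l) /\ mem x U.
Proof. by rewrite mem_meet !mem_inv pr1_pair pr2_pair. Qed.

Context (A_inhabited : inhabited_sub (top (carrier A))).
Context {phi : external_filter A} (cc : combinatory_complete phi).

(** Application is strict, so prefixes of a defined application are defined. The missing last
    argument exists because [A] is inhabited, but only over a cover [e]; hence the hypothesis
    quantifies over [e]. *)
Lemma iter_app_defined_prefix n T (r : Hom T A) (xs : Hom T (pow A n)) :
  (forall T' (e : Hom T' T) (xs : Hom T' (pow A (S n))),
     exists z, pval (iter_app A (S n)) (pair (r ∘ e) xs) z) ->
  exists z, pval (iter_app A n) (pair r xs) z.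
Proof.
have [T' [e [x [he _]]]] := inhabited_local T A_inhabited.
move=> /(_ T' e (pair (xs ∘ e) x)) [z /iter_app_S [w [hw _]]].
rewrite -pair_comp in hw.
by have [w' [hw' _]] := pval_local he hw; exists w'.
Qed.

(** The filter is closed only under defined applications, so the induction also carries a
    description of the members of [dapps B l]: locally they lie below some [r xs]. Monotonicity of
    application then transfers definedness from [r xs x] to [w x]. *)
Lemma filt_dapps (B : Sub A) (l : list (Sub A)) :
  phi B -> List.Forall phi l ->
  (forall T (r : Hom T A) (xs : Hom T (pow A (length l))), mem r B ->
     exists z, pval (iter_app A (length l)) (pair r xs) z) ->
  phi (dapps B l) /\
  forall T (w : Hom T A), mem w (dapps B l) ->
    exists T' (e : Hom T' T) (r : Hom T' A) (xs : Hom T' (pow A (length l))) z,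
      regular_epi e /\ mem r B /\ mem xs (boxes l) /\
      pval (iter_app A (length l)) (pair r xs) z /\ mem (pair (w ∘ e) z) (le A).
Proof.
move=> pB; elim: l => [|U l IH] /= pl def.
  split=> // T w mw; exists T, (idm T), w, (bang T), w.
  split; first exact: regular_epi_id.
  split=> //; split; first by exists (bang T); exact: bang_unique.
  split; first exact/iter_app_O.
  by rewrite comp_id_r; exact: le_refl.
have [pU {}pl] : phi U /\ List.Forall phi l by inversion pl.
have [] := IH pl.
  move=> T r xs mr; apply: iter_app_defined_prefix => T' e xs'.
  by apply: def; apply: mem_comp.
move=> pBl elt; split.
  apply: filt_app => //; apply: applicable_intro => T w x mw mx.
  have [T' [e [r [xs [z [he [mr [mxs [hz le_w]]]]]]]]] := elt _ _ mw.
  have [y /iter_app_S [z' [hz' hy]]] := def _ r (pair xs (x ∘ e)) mr.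
  rewrite (pval_fun hz' hz) in hy.
  have [v [hv _]] := app_mono le_w (le_refl (x ∘ e)) hy.
  rewrite -pair_comp in hv.
  by have [v' [hv' _]] := pval_local he hv; exists v'.
move=> T t /mem_dapp_elim [T1 [e1 [w [x [v [he1 [mw [mx [hv le_t]]]]]]]]].
have [T2 [e2 [r [xs [z [he2 [mr [mxs [hz le_w]]]]]]]]] := elt _ _ mw.
have [y hy] := def _ r (pair xs (x ∘ e2)) mr.
exists T2, (e1 ∘ e2), r, (pair xs (x ∘ e2)), y.
split; first exact: regular_epi_comp.
split=> //; split.
  by apply/(@mem_boxes_cons _ U); split=> //; apply: mem_comp.
split=> //.
have /iter_app_S [z' [hz' hy']] := hy.
rewrite (pval_fun hz' hz) in hy'.
have [v' [hv' le_v']] := app_mono le_w (le_refl (x ∘ e2)) hy'.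
rewrite -pair_comp in hv'.
rewrite -(pval_fun (pval_comp e2 hv) hv') in le_v'.
by apply: le_trans le_v'; rewrite comp_assoc -pair_comp; apply: mem_comp.
Qed.

(* The tracking set is [realizers f] applied to the members of [l], the head of
   [l] being the last parameter because [pow] grows on the right. *)
Lemma tracked_code (l : list (Sub A)) (f : PMap (pow A (S (length l))) A)
    (P Q : family A) (g : Hom (base P) (base Q)) :
  partial_combinatory f -> List.Forall phi l ->
  (forall T (xs : Hom T (pow A (length l))) a (x : Hom T (base P)),
     mem xs (boxes l) -> mem (pair a x) (fib P) ->
     exists v, pval f (pair xs a) v /\ mem (pair v (g ∘ x)) (fib Q)) ->
  tracked phi (P := P) (Q := Q) g.
Proof.
move=> pf pl hf.
have [|pW elt] := @filt_dapps (realizers f) l (cc pf) pl.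
  by move=> T r xs /mem_realizers [h _]; apply: h.
exists (dapps (realizers f) l); split=> // T w a x mw ma.
have [T' [e [r [xs [z [he [mr [mxs [hz le_w]]]]]]]]] := elt _ _ mw.
have ma' : mem (pair (a ∘ e) (x ∘ e)) (fib P).
  by rewrite -pair_comp; apply: mem_comp.
have [v [hv mv]] := hf _ _ _ _ mxs ma'.
have [_ /(_ _ _ hv) [y [/iter_app_S [z' [hz' hy]] le_y]]] := mem_realizers mr.
rewrite (pval_fun hz' hz) in hy.
have [b [hb le_b]] := app_mono le_w (le_refl (a ∘ e)) hy.
rewrite -pair_comp in hb.
have [b' [hb' eb]] := pval_local he hb; exists b'; split=> //.
apply: (mem_local he); rewrite pair_comp eb -comp_assoc.
exact: fib_downset (le_trans le_b le_y) mv.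
Qed.

(** Realizers are kept unchanged, so the identity code without parameters tracks [g]. *)
Lemma tracked_le (P Q : family A) (g : Hom (base P) (base Q)) :
  (forall T (a : Hom T A) (x : Hom T (base P)),
     mem (pair a x) (fib P) -> mem (pair a (g ∘ x)) (fib Q)) ->
  tracked phi (P := P) (Q := Q) g.
Proof.
move=> h; apply: (@tracked_code nil (total pr2)) => //.
  exact/pc_proj/proj_last.
move=> T xs a x _ ma; exists a; split; last exact: h.
by apply/pval_total; rewrite pr2_pair.
Qed.

End Codes.

(** * Families of downsets: reindexing, direct image and conjunction *)

Section Families.
Context {H : HeytingCategory} {A : OPAS H}.
Implicit Types (X Y Z T : H) (P Q R : family A).

Definition terminal_family : family A.
Proof.
refine {| base := one; fib := top (prod A one) |} => T a b x _ _.
by exists (pair a x); exact: comp_id_l.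
Defined.

Lemma mem_terminal_family T (a : Hom T A) (x : Hom T one) :
  mem (pair a x) (fib terminal_family).
Proof. by exists (pair a x); exact: comp_id_l. Qed.

(** The [_aux] lemmas speak of bare subobjects because the downward closure of the families below is
    proved from them. *)
Lemma mem_pull_aux X Y (f : Hom X Y) (S : Sub (prod A Y)) T (a : Hom T A)
    (x : Hom T X) :
  mem (pair a x) (inv (pair pr1 (f ∘ pr2)) S) <-> mem (pair a (f ∘ x)) S.
Proof.
by rewrite mem_inv pair_comp pr1_pair -comp_assoc pr2_pair.
Qed.

Definition pull P X (f : Hom X (base P)) : family A.
Proof.
refine {| base := X; fib := inv (pair pr1 (f ∘ pr2)) (fib P) |}.
move=> T a b x le_ab /mem_pull_aux m; apply/mem_pull_aux.
exact: fib_downset le_ab m.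
Defined.

Lemma mem_pull P X (f : Hom X (base P)) T (a : Hom T A) (x : Hom T X) :
  mem (pair a x) (fib (pull f)) <-> mem (pair a (f ∘ x)) (fib P).
Proof. exact: mem_pull_aux. Qed.

(** An intersection, in contrast to [conj]: one element realizes on both sides, so the identity code
    tracks a parallel pair out of it. *)
Definition meet_pull P Q X (f : Hom X (base P)) (g : Hom X (base Q)) : family A.
Proof.
refine {| base := X; fib := meet (fib (pull f)) (fib (pull g)) |}.
move=> T a b x le_ab /mem_meet [m1 m2]; apply/mem_meet.
split.
  exact: (fib_downset (f := pull f)) le_ab m1.
exact: (fib_downset (f := pull g)) le_ab m2.
Defined.

Lemma mem_meet_pull P Q X (f : Hom X (base P)) (g : Hom X (base Q)) T
    (a : Hom T A) (x : Hom T X) :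
  mem (pair a x) (fib (meet_pull f g)) <->
  mem (pair a (f ∘ x)) (fib P) /\ mem (pair a (g ∘ x)) (fib Q).
Proof. by rewrite /= mem_meet !mem_pull_aux. Qed.

Lemma mem_push_elim_aux P Y (f : Hom (base P) Y) T (a : Hom T A) (y : Hom T Y) :
  mem (pair a y) (exim (pair pr1 (f ∘ pr2)) (fib P)) ->
  exists T' (e : Hom T' T) x,
    regular_epi e /\ mem (pair (a ∘ e) x) (fib P) /\ f ∘ x = y ∘ e.
Proof.
move=> /mem_exim_elim [T' [e [s [he [ms]]]]].
rewrite !pair_comp -comp_assoc => es.
have ea : pr1 ∘ s = a ∘ e by have := f_equal (comp pr1) es; rewrite !pr1_pair.
have ey : f ∘ (pr2 ∘ s) = y ∘ e.
  by have := f_equal (comp pr2) es; rewrite !pr2_pair.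
by exists T', e, (pr2 ∘ s); rewrite -ea pair_eta.
Qed.

Lemma mem_push_intro_aux P Y (f : Hom (base P) Y) T (a : Hom T A) x :
  mem (pair a x) (fib P) ->
  mem (pair a (f ∘ x)) (exim (pair pr1 (f ∘ pr2)) (fib P)).
Proof.
move=> /(mem_exim (pair pr1 (f ∘ pr2))).
by rewrite pair_comp pr1_pair -comp_assoc pr2_pair.
Qed.

(** The codomain of the supine lift of [f]; [tracked_push] and [tracked_push_desc] express its
    universal property. *)
Definition push P Y (f : Hom (base P) Y) : family A.
Proof.
refine {| base := Y; fib := exim (pair pr1 (f ∘ pr2)) (fib P) |}.
move=> T a b y le_ab /mem_push_elim_aux [T' [e [x [he [mx ex]]]]].
apply: (mem_local he); rewrite pair_comp -ex; apply: mem_push_intro_aux.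
by apply: fib_downset mx; rewrite -pair_comp; apply: mem_comp.
Defined.

Lemma mem_push_elim P Y (f : Hom (base P) Y) T (a : Hom T A) (y : Hom T Y) :
  mem (pair a y) (fib (push f)) -> exists T' (e : Hom T' T) x,
    regular_epi e /\ mem (pair (a ∘ e) x) (fib P) /\ f ∘ x = y ∘ e.
Proof. exact: mem_push_elim_aux. Qed.

Lemma mem_push_intro P Y (f : Hom (base P) Y) T (a : Hom T A) x :
  mem (pair a x) (fib P) -> mem (pair a (f ∘ x)) (fib (push f)).
Proof. exact: mem_push_intro_aux. Qed.

(* Church pairing [(x, y, z) |-> z x y], written with de Bruijn projections. *)
Definition pair_code : PMap (pow A 3) A :=
  papp (papp (total pr2) (total (pr2 ∘ pr1 ∘ pr1))) (total (pr2 ∘ pr1)).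

Lemma pair_code_pc : partial_combinatory pair_code.
Proof.
apply: pc_app; last by apply/pc_proj/proj_prev/proj_last.
apply: pc_app; first exact/pc_proj/proj_last.
by apply/pc_proj/proj_prev/proj_prev/proj_last.
Qed.

Definition pairing : Sub A := realizers pair_code.

(* The context is [((c, z), ((p, x), y))]. Projecting it to [(c, z)] yields the
   fibrewise conjunction; the pairing combinator [p] is quantified
   existentially, as the filter contains no single elements. *)
Definition conj_matrix P Q Z (f : Hom Z (base P)) (g : Hom Z (base Q)) :
    Sub (prod (prod A Z) (prod (prod A A) A)) :=
  let p := pr1 ∘ pr1 ∘ pr2 in let x := pr2 ∘ pr1 ∘ pr2 in
  let y := pr2 ∘ pr2 in
  meet (inv p pairing)
    (meet (inv (pair x (f ∘ pr2 ∘ pr1)) (fib P))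
      (meet (inv (pair y (g ∘ pr2 ∘ pr1)) (fib Q))
        (ple (total (pr1 ∘ pr1)) (papp (papp (total p) (total x)) (total y))))).

Lemma mem_conj_matrix P Q Z (f : Hom Z (base P)) (g : Hom Z (base Q))
    T (c p x y : Hom T A) (z : Hom T Z) :
  mem (pair (pair c z) (pair (pair p x) y)) (conj_matrix f g) <->
  mem p pairing /\ mem (pair x (f ∘ z)) (fib P) /\
  mem (pair y (g ∘ z)) (fib Q) /\
  exists px pxy, pval (app A) (pair p x) px /\ pval (app A) (pair px y) pxy /\
    mem (pair c pxy) (le A).
Proof.
(* [pairing] itself unfolds to a meet; generalizing it keeps [mem_meet] from splitting it. *)
rewrite /conj_matrix; move: pairing => N; rewrite !mem_meet !mem_inv !pair_comp -!comp_assoc.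
rewrite !pr1_pair !pr2_pair !pr1_pair !pr2_pair mem_ple.
split=> -[mp [mx [my]]].
  move=> [c' [v [/pval_total ec [/pval_papp [px [y' [hpx [/pval_total ey hv]]]] le_c]]]].
  move: hpx => /pval_papp [p' [x' [/pval_total ep [/pval_total ex hpx]]]].
  move: ec ey ep ex; rewrite -!comp_assoc !(pr1_pair, pr2_pair) => ? ? ? ?.
  by subst; do 3!split=> //; exists px, v.
move=> [px [pxy [hpx [hpxy le_c]]]]; do 3!split=> //.
exists c, pxy; split; last split=> //.
  by apply/pval_total; rewrite -!comp_assoc !pr1_pair.
apply/pval_papp; exists px, y; split; last split=> //.
  apply/pval_papp; exists p, x; split; last split=> //.
    by apply/pval_total; rewrite -!comp_assoc pr2_pair !pr1_pair.
  by apply/pval_total; rewrite -!comp_assoc pr2_pair pr1_pair pr2_pair.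
by apply/pval_total; rewrite -!comp_assoc !pr2_pair.
Qed.

Lemma mem_conj_elim_aux P Q Z (f : Hom Z (base P)) (g : Hom Z (base Q)) T
    (c : Hom T A) (z : Hom T Z) :
  mem (pair c z) (exim pr1 (conj_matrix f g)) ->
  exists T' (e : Hom T' T) p x y px pxy, regular_epi e /\
    mem p pairing /\ mem (pair x (f ∘ z ∘ e)) (fib P) /\
    mem (pair y (g ∘ z ∘ e)) (fib Q) /\
    pval (app A) (pair p x) px /\ pval (app A) (pair px y) pxy /\
    mem (pair (c ∘ e) pxy) (le A).
Proof.
move=> /mem_exim_elim [T' [e [s [he [ms es]]]]].
move: ms; rewrite -(pair_eta s) es -(pair_eta (pr2 ∘ s)).
rewrite -(pair_eta (pr1 ∘ (pr2 ∘ s))) pair_comp => /mem_conj_matrix.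
rewrite !comp_assoc => -[mp [mx [my [px [pxy [hpx [hpxy le_c]]]]]]].
by do 7!eexists; do 6!(split; first eassumption).
Qed.

Lemma mem_conj_intro_aux P Q Z (f : Hom Z (base P)) (g : Hom Z (base Q)) T
    (c p x y px pxy : Hom T A) (z : Hom T Z) :
  mem p pairing -> mem (pair x (f ∘ z)) (fib P) ->
  mem (pair y (g ∘ z)) (fib Q) -> pval (app A) (pair p x) px ->
  pval (app A) (pair px y) pxy -> mem (pair c pxy) (le A) ->
  mem (pair c z) (exim pr1 (conj_matrix f g)).
Proof.
move=> mp mx my hpx hpxy le_c.
rewrite -(pr1_pair (pair c z) (pair (pair p x) y)).
by apply/mem_exim/mem_conj_matrix; do 3!split=> //; exists px, pxy.
Qed.

Definition conj P Q Z (f : Hom Z (base P)) (g : Hom Z (base Q)) : family A.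
Proof.
refine {| base := Z; fib := exim pr1 (conj_matrix f g) |}.
move=> T a b z le_ab /mem_conj_elim_aux.
move=> [T' [e [p [x [y [px [pxy [he [mp [mx [my [hpx [hpxy le_b]]]]]]]]]]]]].
apply: (mem_local he); rewrite pair_comp.
apply: mem_conj_intro_aux hpx hpxy _; rewrite ?comp_assoc //.
by apply: le_trans le_b; rewrite -pair_comp; apply: mem_comp.
Defined.

Lemma mem_conj_elim P Q Z (f : Hom Z (base P)) (g : Hom Z (base Q)) T
    (c : Hom T A) (z : Hom T Z) :
  mem (pair c z) (fib (conj f g)) ->
  exists T' (e : Hom T' T) p x y px pxy, regular_epi e /\
    mem p pairing /\ mem (pair x (f ∘ z ∘ e)) (fib P) /\
    mem (pair y (g ∘ z ∘ e)) (fib Q) /\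
    pval (app A) (pair p x) px /\ pval (app A) (pair px y) pxy /\
    mem (pair (c ∘ e) pxy) (le A).
Proof. exact: mem_conj_elim_aux. Qed.

(** Comes from the clause of [realizers] that demands definedness on all arguments but the last. *)
Lemma pairing_defined T (p x y : Hom T A) : mem p pairing ->
  exists px pxy, pval (app A) (pair p x) px /\ pval (app A) (pair px y) pxy.
Proof.
move=> /mem_realizers [/(_ (pair (pair (bang T) x) y)) [pxy]].
move=> /iter_app_S [px [/iter_app_S [p' [/iter_app_O -> hpx]] hpxy]] _.
by exists px, pxy.
Qed.

Lemma mem_conj_intro P Q Z (f : Hom Z (base P)) (g : Hom Z (base Q)) T
    (p x y px pxy : Hom T A) (z : Hom T Z) :
  mem p pairing -> mem (pair x (f ∘ z)) (fib P) ->
  mem (pair y (g ∘ z)) (fib Q) -> pval (app A) (pair p x) px ->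
  pval (app A) (pair px y) pxy -> mem (pair pxy z) (fib (conj f g)).
Proof.
move=> mp mx my hpx hpxy; apply: mem_conj_intro_aux hpx hpxy _ => //.
exact: le_refl.
Qed.

(** The inequality [p x y k <= k x y] of Church pairing: applying a pair to a selector [k] projects
    it. *)
Lemma pairing_proj T (p x y k kx v px pxy : Hom T A) :
  mem p pairing -> pval (app A) (pair p x) px -> pval (app A) (pair px y) pxy ->
  pval (app A) (pair k x) kx -> pval (app A) (pair kx y) v ->
  exists w, pval (app A) (pair pxy k) w /\ mem (pair w v) (le A).
Proof.
move=> /mem_realizers [_ h] hpx hpxy hkx hv.
have [|w [hw le_w]] := h (pair (pair (pair (bang T) x) y) k) v.
  apply/pval_papp; exists kx, y; split; last split=> //.
    apply/pval_papp; exists k, x; split; last split=> //.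
      by apply/pval_total; rewrite pr2_pair.
    by apply/pval_total; rewrite -!comp_assoc !pr1_pair pr2_pair.
  by apply/pval_total; rewrite -!comp_assoc pr1_pair pr2_pair.
move: hw => /iter_app_S [pxy' [/iter_app_S [px' [/iter_app_S [p' []]]]]].
move=> /iter_app_O -> h1 h2 h3.
rewrite (pval_fun h1 hpx) in h2; rewrite (pval_fun h2 hpxy) in h3.
by exists w.
Qed.

(** * Tracking of the structural morphisms of these families *)

Context (A_inhabited : inhabited_sub (top (carrier A))).
Context {phi : external_filter A} (cc : combinatory_complete phi).

Lemma filt_pairing : phi pairing.
Proof. exact/cc/pair_code_pc. Qed.

Lemma tracked_push P Y (f : Hom (base P) Y) :
  tracked phi (P := P) (Q := push f) f.
Proof. by apply: tracked_le => // T a x; apply: mem_push_intro. Qed.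

Lemma tracked_terminal P (f : Hom (base P) one) :
  tracked phi (P := P) (Q := terminal_family) f.
Proof. by apply: tracked_le => // T a x _; apply: mem_terminal_family. Qed.

(* [sel] stands for one of the two codes of arity 2 selecting an argument. *)
Lemma tracked_conj_proj P Q R Z (f : Hom Z (base P)) (g : Hom Z (base Q))
    (h : Hom Z (base R)) (sel : PMap (pow A 2) A) :
  partial_combinatory sel ->
  (forall T (x y : Hom T A) (z : Hom T Z),
     mem (pair x (f ∘ z)) (fib P) -> mem (pair y (g ∘ z)) (fib Q) ->
     exists v, pval sel (pair (pair (bang T) x) y) v /\
       mem (pair v (h ∘ z)) (fib R)) ->
  tracked phi (P := conj f g) (Q := R) h.
Proof.
move=> psel hsel.
(* The code [(k, c) |-> c k] applies the pair to the selector. *)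
apply: (@tracked_code _ _ A_inhabited _ cc (realizers sel :: nil)
  (papp (total pr2) (total (pr2 ∘ pr1)))).
- apply: pc_app; first exact/pc_proj/proj_last.
  by apply/pc_proj/proj_prev/proj_last.
- by apply: List.Forall_cons => //; apply: cc.
- move=> T ks c z /mem_meet [_ /mem_inv mk] /mem_conj_elim.
  move=> [T' [e [p [x [y [px [pxy [he [mp [mx [my [hpx [hpxy le_c]]]]]]]]]]]]].
  rewrite -comp_assoc in mx; rewrite -comp_assoc in my.
  have [v [hv mv]] := hsel _ _ _ _ mx my.
  have /mem_realizers [_ /(_ _ _ hv)] := mem_comp e mk.
  move=> [u [/iter_app_S [kx [/iter_app_S [k' [/iter_app_O -> hkx]] hu]] le_u]].
  have [w [hw le_w]] := pairing_proj mp hpx hpxy hkx hu.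
  have [ck [hck le_ck]] := app_mono le_c (le_refl _) hw.
  rewrite -pair_comp in hck; have [ck' [hck' eck]] := pval_local he hck.
  exists ck'; split.
    apply/pval_papp; exists c, (pr2 ∘ ks); split; last split=> //.
      by apply/pval_total; rewrite pr2_pair.
    by apply/pval_total; rewrite -comp_assoc pr1_pair.
  apply: (mem_local he); rewrite pair_comp eck -comp_assoc.
  exact: fib_downset (le_trans le_ck (le_trans le_w le_u)) mv.
Qed.

Lemma tracked_conj_fst P Q Z (f : Hom Z (base P)) (g : Hom Z (base Q)) :
  tracked phi (P := conj f g) (Q := P) f.
Proof.
apply: (@tracked_conj_proj _ _ _ _ _ _ _ (total (pr2 ∘ pr1))).
  by apply/pc_proj/proj_prev/proj_last.
move=> T x y z mx _; exists x; split=> //.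
by apply/pval_total; rewrite -comp_assoc pr1_pair pr2_pair.
Qed.

Lemma tracked_conj_snd P Q Z (f : Hom Z (base P)) (g : Hom Z (base Q)) :
  tracked phi (P := conj f g) (Q := Q) g.
Proof.
apply: (@tracked_conj_proj _ _ _ _ _ _ _ (total pr2)).
  exact/pc_proj/proj_last.
move=> T x y z _ my; exists y; split=> //.
by apply/pval_total; rewrite pr2_pair.
Qed.

Lemma tracked_conj_pair P Q R Z (f : Hom Z (base P)) (g : Hom Z (base Q))
    (h : Hom (base R) Z) :
  tracked phi (P := R) (Q := P) (f ∘ h) ->
  tracked phi (P := R) (Q := Q) (g ∘ h) ->
  tracked phi (P := R) (Q := conj f g) h.
Proof.
move=> [U [pU tU]] [V [pV tV]].
(* The code is [(p, u, v, a) |-> p (u a) (v a)], with [u] and [v] ranging over the two given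
   trackers. *)
pose u : Hom (pow A 4) A := pr2 ∘ pr1 ∘ pr1.
pose v : Hom (pow A 4) A := pr2 ∘ pr1.
pose p : Hom (pow A 4) A := pr2 ∘ pr1 ∘ pr1 ∘ pr1.
apply: (@tracked_code _ _ A_inhabited _ cc (V :: U :: pairing :: nil)
  (papp (papp (total p) (papp (total u) (total pr2)))
        (papp (total v) (total pr2)))).
- have pc2 : partial_combinatory (total (pr2 : Hom (pow A 4) A)).
    exact/pc_proj/proj_last.
  apply: pc_app; first apply: pc_app.
  + by apply/pc_proj/proj_prev/proj_prev/proj_prev/proj_last.
  + by apply: pc_app => //; apply/pc_proj/proj_prev/proj_prev/proj_last.
  + by apply: pc_app => //; apply/pc_proj/proj_prev/proj_last.
- by do 3!(apply: List.Forall_cons => //; try exact: filt_pairing).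
- move=> T xs a x /mem_meet [/mem_inv /mem_meet [/mem_inv /mem_meet [_ /mem_inv mp]]].
  move=> /mem_inv mu /mem_inv mv ma.
  have [b [hb mb]] := tU _ _ _ _ mu ma.
  have [c [hc mc]] := tV _ _ _ _ mv ma.
  have [px [pxy [hpx hpxy]]] := pairing_defined b c mp.
  exists pxy; split; last first.
    by apply: mem_conj_intro hpx hpxy; rewrite // comp_assoc.
  have ha : pval (total pr2) (pair xs a) a by apply/pval_total; rewrite pr2_pair.
  apply/pval_papp; exists px, c; split; last split=> //.
    apply/pval_papp; exists (pr2 ∘ (pr1 ∘ (pr1 ∘ xs))), b.
    split; last split=> //.
      by apply/pval_total; rewrite /p -!comp_assoc pr1_pair.
    apply/pval_papp; exists (pr2 ∘ (pr1 ∘ xs)), a; split; last split=> //.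
    by apply/pval_total; rewrite /u -!comp_assoc pr1_pair.
  apply/pval_papp; exists (pr2 ∘ xs), a; split; last split=> //.
  by apply/pval_total; rewrite /v -!comp_assoc pr1_pair.
Qed.

End Families.

(** * Finite limits, images and regular epimorphisms of the total category *)

Section TotalCategory.
Context {H : HeytingCategory} {A : OPAS H}.
Context (A_inhabited : inhabited_sub (top (carrier A))).
Context {phi : external_filter A} (cc : combinatory_complete phi).
Implicit Types P Q R S : family A.

Local Notation D := (DA_cat cc).

(** A realizer in the direct image locally realizes a preimage, so a tracker of [k ∘ f] also tracks
    [k]: values of partial maps descend along covers. *)
Lemma tracked_push_desc P R Y (f : Hom (base P) Y) (k : Hom Y (base R)) :
  tracked phi (P := P) (Q := R) (k ∘ f) ->
  tracked phi (P := push f) (Q := R) k.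
Proof.
move=> [U [pU tU]]; exists U; split=> // T u a y mu.
move=> /mem_push_elim [T' [e [x [he [mx ex]]]]].
have [b [hb mb]] := tU _ _ _ _ (mem_comp e mu) mx.
rewrite -pair_comp in hb; have [b' [hb' eb]] := pval_local he hb.
exists b'; split=> //; apply: (mem_local he).
by rewrite pair_comp eb -comp_assoc -ex comp_assoc.
Qed.

Definition DA_lift P Q (f : Hom (base P) (base Q))
    (t : tracked phi (P := P) (Q := Q) f) : @Hom D P Q := exist _ f t.

Lemma DA_base_eq P Q (f g : @Hom D P Q) : f = g -> proj1_sig f = proj1_sig g.
Proof. by move=> ->. Qed.

(* A parallel pair of base morphisms is tracked out of the meet of the two
   inverse images, so monomorphisms can be tested in the base. *)
Lemma DA_mono P Q (f : @Hom D P Q) : mono f <-> mono (proj1_sig f).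
Proof.
split=> mf T g h efgh; last by apply: DA_hom_eq; exact: mf (DA_base_eq efgh).
have tg : tracked phi (P := meet_pull g h) (Q := P) g.
  by apply: tracked_le => // T' a x /mem_meet_pull [].
have th : tracked phi (P := meet_pull g h) (Q := P) h.
  by apply: tracked_le => // T' a x /mem_meet_pull [].
have e : f ∘ DA_lift tg = f ∘ DA_lift th.
  exact: DA_hom_eq.
exact: DA_base_eq (mf _ _ _ e).
Qed.

Lemma DA_terminal : is_terminal (terminal_family : D).
Proof.
move=> P; exists (DA_lift (tracked_terminal A_inhabited cc (bang _))).
by split=> // f _; apply: DA_hom_eq; apply: bang_unique.
Qed.

Definition DA_conj_fst P Q Z (p : Hom Z (base P)) (q : Hom Z (base Q)) :
    @Hom D (conj p q) P :=
  DA_lift (tracked_conj_fst A_inhabited cc p q).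

Definition DA_conj_snd P Q Z (p : Hom Z (base P)) (q : Hom Z (base Q)) :
    @Hom D (conj p q) Q :=
  DA_lift (tracked_conj_snd A_inhabited cc p q).

Lemma DA_pullback P Q R Z (f : @Hom D P R) (g : @Hom D Q R)
    (p : Hom Z (base P)) (q : Hom Z (base Q)) :
  is_pullback (proj1_sig f) (proj1_sig g) p q ->
  is_pullback f g (DA_conj_fst p q) (DA_conj_snd p q).
Proof.
move=> [e u]; split; first exact: DA_hom_eq.
move=> T a b eab; have [k [[ka kb] uk]] := u _ _ _ (DA_base_eq eab).
have tk : tracked phi (P := T) (Q := conj p q) k.
  by apply: tracked_conj_pair; rewrite ?ka ?kb //; apply: proj2_sig.
exists (DA_lift tk); split; first by split; apply: DA_hom_eq.
move=> k' [/DA_base_eq /= ka' /DA_base_eq /= kb'].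
by apply: DA_hom_eq; apply: uk.
Qed.

(** For a tracked [f] this says that [Q] is the direct image up to isomorphism over the base, that
    is, that [f] is supine. *)
Definition push_covers P Q (f : Hom (base P) (base Q)) : Prop :=
  tracked phi (P := Q) (Q := push f) (idm (base Q)).

(** The coequalized pair of the base lifts to [meet_pull]. The factorization through [f] found in
    the base is tracked out of [push f], hence out of [Q]. *)
Lemma DA_regular_epi_intro P Q (f : @Hom D P Q) :
  regular_epi (proj1_sig f) -> push_covers (proj1_sig f) -> regular_epi f.
Proof.
move=> [Z [p [q [epq u]]]] hf.
have tp : tracked phi (P := meet_pull p q) (Q := P) p.
  by apply: tracked_le => // T' a x /mem_meet_pull [].
have tq : tracked phi (P := meet_pull p q) (Q := P) q.
  by apply: tracked_le => // T' a x /mem_meet_pull [].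
exists (meet_pull p q), (DA_lift tp), (DA_lift tq).
split; first exact: DA_hom_eq.
move=> R t et; have [k [ek uk]] := u _ _ (DA_base_eq et).
have tk : tracked phi (P := Q) (Q := R) k.
  rewrite -(comp_id_r k); apply: (tracked_comp cc) hf.
  by apply: tracked_push_desc; rewrite ek; apply: proj2_sig.
exists (DA_lift tk); split; first exact: DA_hom_eq.
move=> k' /DA_base_eq /= ek'.
by apply: DA_hom_eq; apply: uk.
Qed.

(* Factoring [f] as [sarr M ∘ c] through the direct image along [c], the
   coequalizer property of [f] provides a section of [sarr M]. *)
Lemma DA_regular_epi_elim P Q (f : @Hom D P Q) :
  regular_epi f -> regular_epi (proj1_sig f) /\ push_covers (proj1_sig f).
Proof.
move=> hf; have [Z [p [q [epq u]]]] := hf.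
have [[M c hc ef]] := reg_image (hcat_regular H) (proj1_sig f).
have tm : tracked phi (P := push c) (Q := Q) (sarr M).
  by apply: tracked_push_desc; rewrite ef; apply: proj2_sig.
pose c' : @Hom D P (push c) := DA_lift (tracked_push A_inhabited cc c).
(* [c'] coequalizes [p] and [q] because [f] does and [sarr M] is monic. *)
have [k [ekf _]] : exists! k : @Hom D Q (push c), k ∘ f = c'.
  apply: u; apply: DA_hom_eq; apply: (@smono _ _ M) => /=.
  by rewrite !comp_assoc ef; exact: DA_base_eq epq.
have mk : sarr M ∘ proj1_sig k = idm (base Q).
  have e : DA_lift tm ∘ k = @idm D Q.
    apply: (regular_epi_epi hf); apply: DA_hom_eq => /=.
    have /= ekc := DA_base_eq ekf.
    by rewrite -comp_assoc comp_id_l ekc.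
  exact: DA_base_eq e.
split.
  by rewrite -ef; apply: regular_epi_iso => //; apply: (split_mono_iso (@smono _ _ M) mk).
(* A tracker of the section [k] serves: its output realizes some [x] with [c x = k y], whence
   [f x = y]. *)
have [U [pU tU]] := proj2_sig k; exists U; split=> // T u' a y mu ma.
have [b [hb mb]] := tU _ _ _ _ mu ma; exists b; split=> //.
move: mb => /mem_push_elim [T' [e [x [he [mx ex]]]]].
apply: (mem_local he); rewrite pair_comp comp_id_l.
have <- : proj1_sig f ∘ x = y ∘ e; last exact: mem_push_intro.
by rewrite -ef -comp_assoc ex !comp_assoc mk comp_id_l.
Qed.

(** The base image is given the direct image realizers, so [push_covers] for the cover is the
    tracking of an identity. *)
Lemma DA_image P Q (f : @Hom D P Q) : inhabited (image f).
Proof.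
have [[M c hc ef]] := reg_image (hcat_regular H) (proj1_sig f).
have tm : tracked phi (P := push c) (Q := Q) (sarr M).
  by apply: tracked_push_desc; rewrite ef; apply: proj2_sig.
pose m : @Hom D (push c) Q := DA_lift tm.
have mm : mono m by apply/DA_mono; exact: smono.
constructor; refine {| im_sub := {| sarr := m; smono := mm |};
  im_cover := DA_lift (tracked_push A_inhabited cc c) |}.
  by apply: DA_regular_epi_intro => //; apply: tracked_id.
exact: DA_hom_eq.
Qed.

(* Frobenius and Beck-Chevalley: track [Q] into the conjunction of itself and
   the inverse image of [push f], which lies in [push q] of the pullback. *)
Lemma push_covers_pullback P Q R Z (f : @Hom D P R) (g : @Hom D Q R)
    (p : Hom Z (base P)) (q : Hom Z (base Q)) :
  is_pullback (proj1_sig f) (proj1_sig g) p q ->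
  push_covers (proj1_sig f) ->
  push_covers (P := conj p q) (Q := Q) q.
Proof.
move=> [e u] hf.
have t1 : tracked phi (P := Q)
    (Q := @conj _ _ (push (proj1_sig f)) Q _ (proj1_sig g) (idm (base Q)))
    (idm (base Q)).
  apply: tracked_conj_pair => //; last by rewrite comp_id_l; apply: tracked_id.
  rewrite comp_id_r -(comp_id_l (proj1_sig g)).
  exact: (tracked_comp cc) hf (proj2_sig g).
rewrite /push_covers -(comp_id_l (idm _)); apply: (tracked_comp cc) t1.
apply: tracked_le => // T c y /mem_conj_elim.
move=> [T1 [e1 [r [a [b [ra [rab [he1 [mr [ma [mb [hra [hrab le_c]]]]]]]]]]]]].
move: ma => /mem_push_elim [T2 [e2 [x [he2 [mx ex]]]]].
(* The element [x] over [g y] and [y] itself determine a point of the pullback. *)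
have [k [[kx ky] _]] : exists! k, p ∘ k = x /\ q ∘ k = y ∘ e1 ∘ e2.
  by apply: u; rewrite ex !comp_assoc.
apply: (mem_local he1); apply: (mem_local he2); rewrite !pair_comp !comp_id_l.
rewrite -ky.
apply: (fib_downset (f := push (P := conj p q) q) (b := rab ∘ e2)).
  by rewrite -pair_comp; apply: mem_comp.
apply: mem_push_intro; apply: (mem_conj_intro (x := a ∘ e2) (y := b ∘ e2)).
- exact: mem_comp mr.
- by rewrite kx.
- rewrite ky -pair_comp; apply: mem_comp.
  by rewrite comp_id_l in mb.
- by rewrite -pair_comp; apply: pval_comp hra.
- by rewrite -pair_comp; apply: pval_comp hrab.
Qed.

Lemma DA_regular : regular D.
Proof.
split.
- by constructor; exists (terminal_family : D); apply: DA_terminal.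
- move=> P Q R f g.
  have [[Z p q h]] := reg_pullback (hcat_regular H) (proj1_sig f) (proj1_sig g).
  by constructor; econstructor; apply: DA_pullback h.
- exact: DA_image.
- move=> S P Q R f g p q h /DA_regular_epi_elim [hf1 hf2].
  have [[Z p0 q0 h0]] := reg_pullback (hcat_regular H) (proj1_sig f) (proj1_sig g).
  (* A given pullback is isomorphic to the constructed one, where stability can be checked. *)
  have [i [hi [_ <-]]] := is_pullback_unique (DA_pullback h0) h.
  apply: regular_epi_iso_r hi; apply: DA_regular_epi_intro.
    exact: reg_stable (hcat_regular H) _ _ _ _ _ _ _ _ h0 hf1.
  exact: push_covers_pullback h0 hf2.
Qed.

End TotalCategory.

(** * The universal property of the category of fractions *)

Section FractionsUniversal.
Context {C D : Category} (W : forall X Y : C, Hom X Y -> Prop).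
Context (S : Functor C D).
Hypothesis W_iso : forall X Y (w : Hom X Y), W w -> is_iso (fmap S w).

Fixpoint frac_eval X Y (a : frac W X Y) : Hom (S X) (S Y) :=
  match a with
  | @fr_in _ _ _ _ f => fmap S f
  | @fr_inv _ _ _ _ _ hw =>
      proj1_sig (constructive_indefinite_description _ (W_iso hw))
  | @fr_comp _ _ _ _ _ b a => frac_eval b ∘ frac_eval a
  end.

Lemma frac_eval_eq X Y (a b : frac W X Y) :
  frac_eq a b -> frac_eval a = frac_eval b.
Proof.
elim=> {X Y a b} //=.
- by move=> X Y a b c _ -> _.
- by move=> X Y Z b b' a a' _ -> _ ->.
- by move=> X Y a; rewrite fmap_id comp_id_l.
- by move=> X Y a; rewrite fmap_id comp_id_r.
- by move=> X Y Z T c b a; rewrite comp_assoc.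
- by move=> X Y Z g f; rewrite fmap_comp.
- move=> X Y w hw; case: constructive_indefinite_description => v [/= e _].
  by rewrite e fmap_id.
- move=> X Y w hw; case: constructive_indefinite_description => v [/= _ e].
  by rewrite e fmap_id.
Qed.

Definition frac_extension : Functor (frac_cat W) D.
Proof.
refine {| fobj := (fun X => S X) : frac_cat W -> D;
          fmap X Y (m : @Hom (frac_cat W) X Y) := frac_eval (frac_repr m) |}.
- move=> X; rewrite (frac_eval_eq (frac_repr_class _)) /=; exact: fmap_id.
- by move=> X Y Z g f; rewrite (frac_eval_eq (frac_repr_class _)).
Defined.

Definition frac_extension_iso :
  NatIso (functor_comp frac_extension (frac_functor W)) S.
Proof.
refine {| component X := idm (S X)
            : Hom (functor_comp frac_extension (frac_functor W) X) (S X) |}.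
- move=> X Y f /=; rewrite (frac_eval_eq (frac_repr_class _)) /=.
  by rewrite comp_id_l comp_id_r.
- by move=> X; exists (idm (S X)); rewrite comp_id_l.
Defined.

(** Induction on the formal composite; at a formal inverse, naturality at [w] is cancelled by the
    invertible [fmap S w]. *)
Lemma frac_extension_natural (G : Functor (frac_cat W) D)
    (alpha : NatIso (functor_comp G (frac_functor W)) S) X Y (a : frac W X Y) :
  alpha Y ∘ fmap G (frac_class a : @Hom (frac_cat W) X Y) =
  frac_eval a ∘ alpha X.
Proof.
elim: a => {X Y} /=.
- move=> X Y f; exact: (naturality alpha f).
- move=> X Y w hw; case: constructive_indefinite_description => v [/= vw _].
  set g := fmap G _; pose g' := fmap (functor_comp G (frac_functor W)) w.
  have gg' : g' ∘ g = idm _.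
    rewrite /g /g' /= -fmap_comp -fmap_id; congr (fmap G _).
    apply/frac_class_eq; apply: fe_trans (fe_inv_r hw).
    by apply: fe_comp; apply: frac_repr_class.
  rewrite -[LHS]comp_id_l -vw -comp_assoc (comp_assoc (fmap S w)).
  by rewrite -(naturality alpha w) -/g' -(comp_assoc (alpha Y)) gg' comp_id_r.
- move=> X Y Z b IHb a IHa.
  have -> : frac_class (fr_comp b a) =
      (frac_class b : @Hom (frac_cat W) Y Z) ∘
      (frac_class a : @Hom (frac_cat W) X Y).
    apply/frac_class_eq/fe_sym.
    by apply: fe_comp; apply: frac_repr_class.
  by rewrite fmap_comp comp_assoc IHb -comp_assoc IHa comp_assoc.
Qed.

Lemma frac_factors_uniquely : factors_uniquely (frac_functor W) S.
Proof.
exists frac_extension, frac_extension_iso => G alpha.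
unshelve eexists.
  (* The extension agrees with [S] on objects and its comparison isomorphism is the identity, so
     [alpha] itself is the isomorphism sought. *)
  refine {| component X := alpha X : Hom (G X) (frac_extension X) |}.
    move=> X Y m; rewrite -{1}(frac_reprK m); exact: frac_extension_natural.
  move=> X; exact: (component_iso alpha X).
by move=> X; exact: comp_id_l.
Qed.

End FractionsUniversal.

(** * [Sigma] as a subfunctor and inhabitedness of the filter *)

Section Realized.
Context {H : HeytingCategory} {A : OPAS H}.
Context (A_inhabited : inhabited_sub (top (carrier A))).
Context {phi : external_filter A} (cc : combinatory_complete phi).
Implicit Types P Q R : family A.

Local Notation D := (DA_cat cc).

Lemma mem_Sigma_intro P T (a : Hom T A) (x : Hom T (base P)) :
  mem (pair a x) (fib P) -> mem x (Sigma cc P).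
Proof. by move=> /(mem_exim pr2); rewrite pr2_pair. Qed.

Lemma mem_Sigma_elim P T (x : Hom T (base P)) :
  mem x (Sigma cc P) ->
  exists T' (e : Hom T' T) a, regular_epi e /\ mem (pair a (x ∘ e)) (fib P).
Proof.
move=> /mem_exim_elim [T' [e [s [he [ms es]]]]].
by exists T', e, (pr1 ∘ s); rewrite -es pair_eta.
Qed.

Lemma subfunctor_of_inhabited :
  (forall U : Sub A, phi U -> inhabited_sub U) -> defines_subfunctor (Sigma cc).
Proof.
move=> inh P Q f; have [U [pU tU]] := proj2_sig f.
have mS : mem (sarr (Sigma cc P)) (Sigma cc P).
  by exists (idm _); rewrite comp_id_r.
have [T1 [e1 [a [he1 ma]]]] := mem_Sigma_elim mS.
have [T2 [e2 [u [he2 mu]]]] := inhabited_local T1 (inh _ pU).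
have ma2 : mem (pair (a ∘ e2) (sarr (Sigma cc P) ∘ e1 ∘ e2)) (fib P).
  by rewrite -pair_comp; apply: mem_comp.
have [b [_ mb]] := tU _ _ _ _ mu ma2.
(* The restriction of [f] to [Sigma] is a membership statement, testable on the covers [e1] and
   [e2]. *)
rewrite -/(mem (fmap (DA_fibration cc) f ∘ sarr (Sigma cc P)) (Sigma cc Q)).
apply: (mem_local he1); apply: (mem_local he2).
by apply: (mem_Sigma_intro (a := b)); rewrite -!comp_assoc in mb *.
Qed.

Lemma inhabited_of_subfunctor :
  defines_subfunctor (Sigma cc) -> forall U : Sub A, phi U -> inhabited_sub U.
Proof.
move=> h U pU.
have fU : family_downset (inv (pr1 : Hom (prod A one) A) U).
  move=> T a b x le_ab; rewrite !mem_inv !pr1_pair.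
  exact: filt_downset pU _ _ _ le_ab.
(* [U] as a family over the point; its [Sigma] is the support of [U]. *)
pose Q : family A := {| base := one; fib := _; fib_downset := fU |}.
have t : tracked phi (P := terminal_family) (Q := Q) (idm one).
{ apply: (@tracked_code _ _ A_inhabited _ cc (U :: nil) (total (pr2 ∘ pr1))).
  - by apply/pc_proj/proj_prev/proj_last.
  - by apply: List.Forall_cons.
  - move=> T us a x /mem_meet [_ /mem_inv mu] _; exists (pr2 ∘ us).
    split; first by apply/pval_total; rewrite -comp_assoc pr1_pair.
    by apply/mem_inv; rewrite pr1_pair. }
have [g eg] := h _ _ (DA_lift cc t).
(* As [A] is inhabited, the terminal family has full [Sigma], and so then has [Q]. *)
have [T1 [e1 [a [he1 _]]]] := inhabited_local one A_inhabited.
have m1 : mem e1 (Sigma cc terminal_family).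
  exact: (mem_Sigma_intro (P := terminal_family) (mem_terminal_family a e1)).
have /mem_Sigma_elim [T2 [e2 [u [he2 /mem_inv mu]]]] : mem e1 (Sigma cc Q).
  by case: m1 => k <-; exists (g ∘ k); rewrite comp_assoc eg /= comp_id_l.
rewrite pr1_pair in mu.
exact: inhabited_intro (regular_epi_comp he1 he2) mu.
Qed.

(** * Regularity of the subfunctor and inversion of supine monomorphisms *)

Context (h : defines_subfunctor (Sigma cc)).
Local Notation S := (subfunctor h).

Lemma sarr_subfunctor P Q (f : @Hom D P Q) :
  sarr (Sigma cc Q) ∘ fmap S f = proj1_sig f ∘ sarr (Sigma cc P).
Proof. by rewrite /=; case: constructive_indefinite_description. Qed.

Lemma sarr_subfunctor_comp P Q (f : @Hom D P Q) T (k : Hom T (S P)) :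
  sarr (Sigma cc Q) ∘ (fmap S f ∘ k) = proj1_sig f ∘ (sarr (Sigma cc P) ∘ k).
Proof.
have := f_equal (fun m => m ∘ k) (sarr_subfunctor f).
by rewrite -!comp_assoc.
Qed.

Lemma mono_subfunctor P Q (f : @Hom D P Q) : mono f -> mono (fmap S f).
Proof.
move=> /DA_mono mf T a b eab; apply: (@smono _ _ (Sigma cc P)).
by apply: (mf A_inhabited); rewrite -!sarr_subfunctor_comp eab.
Qed.

(** A point of [Sigma] of [Q] locally has a realizer, and an element of the inhabited tracker turns
    it into a realizer in [push f], thus into a realized preimage. A cover therefore factors through
    [fmap S f]. *)
Lemma regular_epi_subfunctor P Q (f : @Hom D P Q) :
  push_covers (phi := phi) (proj1_sig f) -> regular_epi (fmap S f).
Proof.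
move=> [V [pV tV]].
have mS : mem (sarr (Sigma cc Q)) (Sigma cc Q).
  by exists (idm _); rewrite comp_id_r.
have [T1 [e1 [b [he1 mb]]]] := mem_Sigma_elim mS.
have [T2 [e2 [v [he2 mv]]]] :=
  inhabited_local T1 (inhabited_of_subfunctor h pV).
have mb2 : mem (pair (b ∘ e2) (sarr (Sigma cc Q) ∘ e1 ∘ e2)) (fib Q).
  by rewrite -pair_comp; apply: mem_comp.
have [c [_ mc]] := tV _ _ _ _ mv mb2.
have [T3 [e3 [x [he3 [mx ex]]]]] := mem_push_elim mc.
have [k ek] := mem_Sigma_intro mx.
apply: (regular_epi_cancel (s := k)).
have -> : fmap S f ∘ k = e1 ∘ e2 ∘ e3.
  apply: (@smono _ _ (Sigma cc Q)).
  by rewrite sarr_subfunctor_comp ek ex comp_id_l !comp_assoc.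
by apply: regular_epi_comp => //; apply: regular_epi_comp.
Qed.

Lemma terminal_subfunctor (X : D) : is_terminal X -> is_terminal (S X).
Proof.
move=> hX.
have [i /(fmap_iso S) hi] := is_terminal_unique (DA_terminal A_inhabited (cc := cc)) hX.
apply: is_terminal_iso hi => T.
have [T1 [e1 [a [he1 _]]]] := inhabited_local T A_inhabited.
have [k _] : mem (bang T) (Sigma cc terminal_family).
  apply: (mem_local he1).
  exact: (mem_Sigma_intro (P := terminal_family) (mem_terminal_family a _)).
exists k; split=> // k' _; apply: (@smono _ _ (Sigma cc terminal_family)).
exact: bang_unique.
Qed.

(** It suffices that a point of the base pullback lies in [Sigma] once both its projections do:
    locally choose realizers [x], [y] of these and [r] in the inhabited [pairing]; then [r x y]
    realizes the point. *)
Lemma pullback_subfunctor (W X Y Z : D) (f : Hom X Z) (g : Hom Y Z)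
    (p : Hom W X) (q : Hom W Y) :
  is_pullback f g p q ->
  is_pullback (fmap S f) (fmap S g) (fmap S p) (fmap S q).
Proof.
move=> hW; have [[B p0 q0 hB]] :=
  reg_pullback (hcat_regular H) (proj1_sig f) (proj1_sig g).
have hB' := DA_pullback A_inhabited (cc := cc) hB.
have [i [/(fmap_iso S) hi [<- <-]]] := is_pullback_unique hB' hW.
rewrite !fmap_comp; apply: is_pullback_iso hi.
have [eB _] := hB'; split; first by rewrite -!fmap_comp eB.
move=> T a b eab; have [_ u] := hB.
have [|k [[ka kb] uk]] := u _ (sarr (Sigma cc X) ∘ a) (sarr (Sigma cc Y) ∘ b).
  by rewrite -!sarr_subfunctor_comp eab.
have [l el] : mem k (Sigma cc (conj p0 q0)).
  have [T1 [e1 [x [he1 mx]]]] :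
      exists T' (e : Hom T' T) x, regular_epi e /\
        mem (pair x (p0 ∘ k ∘ e)) (fib X).
    by apply: mem_Sigma_elim; exists a.
  have [T2 [e2 [y [he2 my]]]] :
      exists T' (e : Hom T' T1) y, regular_epi e /\
        mem (pair y (q0 ∘ k ∘ e1 ∘ e)) (fib Y).
    by apply: mem_Sigma_elim; exists (b ∘ e1); rewrite kb comp_assoc.
  have [T3 [e3 [r [he3 mr]]]] :=
    inhabited_local T2 (inhabited_of_subfunctor h (filt_pairing cc)).
  have [rx [rxy [hrx hrxy]]] := pairing_defined (x ∘ e2 ∘ e3) (y ∘ e3) mr.
  apply: (mem_local he1); apply: (mem_local he2); apply: (mem_local he3).
  apply: mem_Sigma_intro; apply: mem_conj_intro mr _ _ hrx hrxy.
    by rewrite !comp_assoc -!pair_comp; do 2!apply: mem_comp.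
  by rewrite !comp_assoc -pair_comp; apply: mem_comp.
exists l; split.
  split; [apply: (@smono _ _ (Sigma cc X)) | apply: (@smono _ _ (Sigma cc Y))].
    by rewrite sarr_subfunctor_comp el.
  by rewrite sarr_subfunctor_comp el.
move=> l' [la lb]; apply: (@smono _ _ (Sigma cc (conj p0 q0))).
rewrite el; apply: uk; split.
  by rewrite -la sarr_subfunctor_comp.
by rewrite -lb sarr_subfunctor_comp.
Qed.

Lemma regular_subfunctor : regular_functor S.
Proof.
split.
- exact: DA_regular.
- exact: hcat_regular.
- exact: terminal_subfunctor.
- exact: pullback_subfunctor.
- move=> P Q e /(DA_regular_epi_elim A_inhabited) [_].
  exact: regular_epi_subfunctor.
Qed.

(** Supineness is applied to the lift of [f] from [P] to [push f], with the identity below. *)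
Lemma supine_push_covers P Q (f : @Hom D P Q) :
  supine (DA_fibration cc) f -> push_covers (phi := phi) (proj1_sig f).
Proof.
move=> hf.
have t := tracked_push A_inhabited cc (proj1_sig f).
have [|k [[ek _] _]] := hf _ (DA_lift cc t) (idm (base Q)).
  by rewrite /= comp_id_l.
by rewrite /push_covers -ek; apply: proj2_sig.
Qed.

Lemma supine_mono_iso P Q (f : @Hom D P Q) :
  supine_mono (DA_fibration cc) f -> is_iso (fmap S f).
Proof.
move=> [mf sf]; apply: mono_regular_epi_iso; first exact: mono_subfunctor.
exact/regular_epi_subfunctor/supine_push_covers.
Qed.

End Realized.

Theorem lemma2p2p2 (H : HeytingCategory) (A : OPAS H)
    (A_inhabited : inhabited_sub (top (carrier A)))
    (phi : external_filter A) (cc : combinatory_complete phi) :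
  (defines_subfunctor (Sigma cc) <-> forall U : Sub A, phi U -> inhabited_sub U)
  /\
  (forall h : defines_subfunctor (Sigma cc),
     regular_functor (subfunctor h) /\
     factors_uniquely (Asm_functor (DA_fibration cc)) (subfunctor h)).
Proof.
split.
  split; first exact: inhabited_of_subfunctor.
  exact: subfunctor_of_inhabited.
move=> h; split; first exact: regular_subfunctor.
apply: frac_factors_uniquely => P Q w; exact: supine_mono_iso.
Qed.
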